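(* For all $\delta \ge 0$, $K \ge 0$, $\varepsilon>0$, $M \ge 1$ there is a constant $A = A(\delta,K,\varepsilon,M)\ge 1$ with the following property. Let $X$ be a complete geodesic $\delta$-hyperbolic space and let $b \in \hat{\mathcal{B}}(X)$ have basepoint $\omega_b$. Suppose that $X$ is $K$-roughly starlike from $\omega_{b}$ and that $\rho_{\varepsilon,b}(x)=e^{-\varepsilon b(x)}$ is a GH-density with constant $M$. Then every geodesic in $X$ is an $A$-uniform curve in $X_{\varepsilon,b}$. Consequently $X_{\varepsilon,b}$ is an $A$-uniform metric space. Furthermore, $X_{\varepsilon,b}$ is bounded if and only if $b \in \mathcal{D}(X)$.
   Context: Hyperbolicity. $(X,d)$ is a metric space, $|xy|=d(x,y)$. A geodesic is an isometric map $\gamma:I\to X$ of an interval $I\subset\mathbb{R}$ (or its image); $X$ is geodesic if any two points are joined by a geodesic. A geodesic space $X$ is $\delta$-hyperbolic if for each geodesic triangle every point of an edge is within distance $\delta$ of the union of the other two edges. The Gromov product is $(x|y)_p=\frac12(|xp|+|yp|-|xy|)$. A sequence $\{x_n\}$ converges to infinity if $(x_n|x_m)_p\to\infty$ as $m,n\to\infty$; the Gromov boundary $\partial X$ is the set of such sequences modulo $\{x_n\}\sim\{y_n\}$ iff $(x_n|y_n)_p\to\infty$ (independent of $p$). A geodesic ray $\gamma:[0,\infty)\to X$ determines the class $[\gamma]\in\partial X$ of $\{\gamma(n)\}$; we write $\gamma\in\xi$ if $[\gamma]=\xi$, and for $\gamma:(-\infty,0]\to X$ we write $\gamma\in\xi$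 if $\{\gamma(-n)\}\in\xi$. Busemann functions. For a geodesic ray $\gamma$, $b_\gamma(x)=\lim_{t\to\infty}(d(\gamma(t),x)-t)$. $\mathcal{B}(X)=\{b_\gamma+s\}$ ($\gamma$ a geodesic ray, $s\in\mathbb{R}$); the basepoint of $b=b_\gamma+s$ is $\omega_b=[\gamma]\in\partial X$. $\mathcal{D}(X)=\{d(\cdot,z)+s : z\in X, s\in\mathbb{R}\}$; the basepoint of $b=d(\cdot,z)+s$ is $\omega_b=z$. $\hat{\mathcal{B}}(X)=\mathcal{B}(X)\cup\mathcal{D}(X)$. For $\omega\in\partial X$, $\partial_\omega X=\partial X\setminus\{\omega\}$; for $\omega\in X$, $\partial_\omega X=\partial X$. Rough starlikeness. For $z\in X$, $X$ is $K$-roughly starlike from $z$ if (1) for each $x\in X$ there is a geodesic ray $\gamma:[0,\infty)\to X$ with $\gamma(0)=z$ and $\mathrm{dist}(x,\gamma)\le K$; (2) for each $\xi\in\partial X$ there is a geodesic ray $\gamma$ with $\gamma(0)=z$ and $\gamma\in\xi$. For $\omega\in\partial X$, $X$ is $K$-roughly starlike from $\omega$ if (1) for each $x\in X$ there is a geodesic line $\gamma:\mathbb{R}\to X$ with $\mathrm{dist}(x,\gamma)\le K$ and $\gamma|_{(-\infty,0]}\in\omega$; (2) for each $\xi\in\partial_\omega X$ there is a geodesic line $\gamma$ with $\gamma|_{[0,\infty)}\in\xi$ and $\gamma|_{(-\infty,0]}\in\omega$. Conformal deformation. For a continuous $\rho:X\to(0,\infty)$ (a density), $\ell_\rho(\gamma)=\int_\gamma\rho\,ds$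 and $X_\rho=(X,d_\rho)$ with $d_\rho(x,y)=\inf\ell_\rho(\gamma)$ over all curves joining $x$ to $y$. $\rho$ is a GH-density with constant $M\ge1$ if $\ell_\rho(\gamma)\le M d_\rho(x,y)$ for all $x,y\in X$ and every geodesic $\gamma$ of $X$ joining $x$ to $y$. $X_{\varepsilon,b}=(X,d_{\varepsilon,b})$ is the conformal deformation with $\rho_{\varepsilon,b}=e^{-\varepsilon b}$. Uniform curves and spaces. Let $(\Omega,d)$ be an incomplete metric space, $\partial\Omega=\bar\Omega\setminus\Omega$ (boundary in the completion), $d_\Omega(x)=\mathrm{dist}(x,\partial\Omega)$. Let $\gamma:I\to\Omega$ be a curve on an interval $I\subset\mathbb{R}$ with endpoints $t_-\in[-\infty,\infty)$, $t_+\in(-\infty,\infty]$, $\ell$ denoting length, $I_{\le t}=\{s\in I:s\le t\}$, $I_{\ge t}=\{s\in I:s\ge t\}$. If $\ell(\gamma)<\infty$, let $\gamma_\pm\in\bar\Omega$ be the limits of $\gamma(t)$ as $t\to t_\pm$; $\gamma$ is $A$-uniform if (i) $\ell(\gamma)\le A\,d(\gamma_-,\gamma_+)$ and (ii) $\min\{\ell(\gamma|_{I_{\le t}}),\ell(\gamma|_{I_{\ge t}})\}\le A\,d_\Omega(\gamma(t))$ for all $t\in I$. If $\ell(\gamma)=\infty$, $\gamma$ is $A$-uniform if (ii) holds and $d(\gamma(s),\gamma(t))\to\infty$ as $s\to t_-$, $t\to t_+$. $\Omega$ is $A$-uniform if any two points of $\Omega$ can be joined by an $A$-uniform curve. *)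

(* Defs.v *)
From Stdlib Require Export Reals Rlimit.
From Coquelicot Require Export Coquelicot.

Set Implicit Arguments.
Unset Strict Implicit.
Unset Printing Implicit Defensive.

Open Scope R_scope.

(* A space [X] and its conformal deformation [X_rho] are two metrics on one
   carrier, so every notion below is stated for a bare distance function
   [d : T -> T -> R].  [is_metric] lists the axioms of [Rlimit.Metric_Space]. *)

Definition is_metric (T : Type) (d : T -> T -> R) : Prop :=
  (forall x y, d x y >= 0) /\
  (forall x y, d x y = d y x) /\
  (forall x y, d x y = 0 <-> x = y) /\
  (forall x y z, d x y <= d x z + d z y).

Definition metric_bounded (T : Type) (d : T -> T -> R) : Prop :=
  exists C : R, forall x y, d x y <= C.

Definition cauchy_seq (T : Type) (d : T -> T -> R) (u : nat -> T) : Prop :=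
  forall eps : R, 0 < eps ->
  exists N : nat, forall m n : nat,
    (N <= m)%nat -> (N <= n)%nat -> d (u m) (u n) < eps.

Definition seq_limit (T : Type) (d : T -> T -> R) (u : nat -> T) (x : T) : Prop :=
  is_lim_seq (fun n => d (u n) x) (Finite 0).

Definition metric_complete (T : Type) (d : T -> T -> R) : Prop :=
  forall u : nat -> T, cauchy_seq d u -> exists x, seq_limit d u x.

(* [+oo] when [S] is empty. *)
Definition dist_to (T : Type) (d : T -> T -> R) (x : T) (S : T -> Prop) : Rbar :=
  Glb_Rbar (fun r => exists y, S y /\ r = d x y).

(* A map [I -> T] on an interval [I] is represented by a total function
   [g : R -> T]; only its values on [I] are used. *)

Definition is_interval (I : R -> Prop) : Prop :=
  (exists t, I t) /\
  (forall a b c, I a -> I b -> a <= c <= b -> I c).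

Definition closed_itv (a b : R) : R -> Prop := fun t => a <= t <= b.
Definition half_line : R -> Prop := fun t => 0 <= t.
Definition whole_line : R -> Prop := fun _ => True.

Definition left_end (I : R -> Prop) : Rbar := Glb_Rbar I.
Definition right_end (I : R -> Prop) : Rbar := Lub_Rbar I.

Definition trace (T : Type) (g : R -> T) (I : R -> Prop) : T -> Prop :=
  fun y => exists t, I t /\ g t = y.

Definition is_curve (T : Type) (d : T -> T -> R) (I : R -> Prop) (g : R -> T) : Prop :=
  is_interval I /\
  forall t, I t -> forall eps : R, 0 < eps ->
  exists eta : R, 0 < eta /\
    forall s, I s -> Rabs (s - t) < eta -> d (g s) (g t) < eps.

Definition joins (T : Type) (g : R -> T) (a b : R) (x y : T) : Prop :=
  a <= b /\ g a = x /\ g b = y.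

(* [t 0 <= t 1 <= ... <= t (n + 1)] are the points of a subdivision. *)
Definition curve_length (T : Type) (d : T -> T -> R) (g : R -> T) (I : R -> Prop) : Rbar :=
  Lub_Rbar (fun r => exists (n : nat) (t : nat -> R),
    (forall i, (i <= S n)%nat -> I (t i)) /\
    (forall i, (i <= n)%nat -> t i <= t (S i)) /\
    r = sum_n (fun i => d (g (t i)) (g (t (S i)))) n).

Definition geodesic (T : Type) (d : T -> T -> R) (I : R -> Prop) (g : R -> T) : Prop :=
  is_interval I /\
  forall s t, I s -> I t -> d (g s) (g t) = Rabs (s - t).

Definition geodesic_joining (T : Type) (d : T -> T -> R) (g : R -> T) (a b : R)
    (x y : T) : Prop :=
  geodesic d (closed_itv a b) g /\ joins g a b x y.

Definition geodesic_space (T : Type) (d : T -> T -> R) : Prop :=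
  forall x y : T, exists (g : R -> T) (a b : R), geodesic_joining d g a b x y.

Definition geodesic_ray (T : Type) (d : T -> T -> R) (g : R -> T) : Prop :=
  geodesic d half_line g.
Definition geodesic_line (T : Type) (d : T -> T -> R) (g : R -> T) : Prop :=
  geodesic d whole_line g.

(* It is enough to name the first edge: the hypotheses are invariant under
   cyclic relabelling of the vertices [x], [y], [z]. *)
Definition delta_hyperbolic (T : Type) (d : T -> T -> R) (delta : R) : Prop :=
  forall (x y z : T) (g1 g2 g3 : R -> T) (a1 b1 a2 b2 a3 b3 : R),
    geodesic_joining d g1 a1 b1 x y ->
    geodesic_joining d g2 a2 b2 y z ->
    geodesic_joining d g3 a3 b3 z x ->
    forall p, trace g1 (closed_itv a1 b1) p ->
      Rbar_le
        (dist_to d p (fun q => trace g2 (closed_itv a2 b2) q \/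
                               trace g3 (closed_itv a3 b3) q))
        (Finite delta).

Definition gromov_product (T : Type) (d : T -> T -> R) (p x y : T) : R :=
  (d x p + d y p - d x y) / 2.

Definition converges_to_infinity (T : Type) (d : T -> T -> R) (u : nat -> T) : Prop :=
  forall (p : T) (C : R), exists N : nat, forall m n : nat,
    (N <= m)%nat -> (N <= n)%nat -> C <= gromov_product d p (u n) (u m).

Definition seq_equiv (T : Type) (d : T -> T -> R) (u v : nat -> T) : Prop :=
  forall p : T, is_lim_seq (fun n => gromov_product d p (u n) (v n)) p_infty.

(* A point of the Gromov boundary is an equivalence class: a set of sequences. *)
Definition seq_class (T : Type) (d : T -> T -> R) (u : nat -> T) : (nat -> T) -> Prop :=
  fun v => converges_to_infinity d v /\ seq_equiv d u v.

Definition gromov_boundary (T : Type) (d : T -> T -> R) (xi : (nat -> T) -> Prop) : Prop :=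
  exists u, converges_to_infinity d u /\ xi = seq_class d u.

Definition forward_in (T : Type) (g : R -> T) (xi : (nat -> T) -> Prop) : Prop :=
  xi (fun n => g (INR n)).
Definition backward_in (T : Type) (g : R -> T) (xi : (nat -> T) -> Prop) : Prop :=
  xi (fun n => g (- INR n)).

Inductive basepoint (T : Type) : Type :=
  | Inner (z : T)
  | AtInfinity (om : (nat -> T) -> Prop).

Definition busemann (T : Type) (d : T -> T -> R) (g : R -> T) (x : T) : R :=
  real (Lim (fun t => d (g t) x - t) p_infty).

(* [has_basepoint d b w]: [b] belongs to B(X) (case [AtInfinity]) or to D(X)
   (case [Inner]), hence to their union, and [w] is its basepoint. *)
Definition has_basepoint (T : Type) (d : T -> T -> R) (b : T -> R) (w : basepoint T) : Prop :=
  match w with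
  | Inner z => exists s : R, forall x, b x = d x z + s
  | AtInfinity om =>
      exists (g : R -> T) (s : R),
        geodesic_ray d g /\
        (forall x, b x = busemann d g x + s) /\
        om = seq_class d (fun n => g (INR n))
  end.

Definition in_D (T : Type) (d : T -> T -> R) (b : T -> R) : Prop :=
  exists z : T, has_basepoint d b (Inner z).

Definition roughly_starlike (T : Type) (d : T -> T -> R) (K : R) (w : basepoint T) : Prop :=
  match w with
  | Inner z =>
      (forall x, exists g, geodesic_ray d g /\ g 0 = z /\
         Rbar_le (dist_to d x (trace g half_line)) (Finite K)) /\
      (forall xi, gromov_boundary d xi ->
         exists g, geodesic_ray d g /\ g 0 = z /\ forward_in g xi)
  | AtInfinity om =>
      (forall x, exists g, geodesic_line d g /\
         Rbar_le (dist_to d x (trace g whole_line)) (Finite K) /\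
         backward_in g om) /\
      (forall xi, gromov_boundary d xi -> xi <> om ->
         exists g, geodesic_line d g /\ forward_in g xi /\ backward_in g om)
  end.

Definition density (T : Type) (d : T -> T -> R) (rho : T -> R) : Prop :=
  (forall x, 0 < rho x) /\
  (forall x (eps : R), 0 < eps -> exists eta : R, 0 < eta /\
     forall y, d x y < eta -> Rabs (rho y - rho x) < eps).

Definition arclength (T : Type) (d : T -> T -> R) (g : R -> T) (a t : R) : R :=
  real (curve_length d g (closed_itv a t)).

(* The arclength parametrization of a rectifiable [g] on [[a, b]]: its value at
   [u] is [g t] for the first time [t] at which the arclength reaches [u]. *)
Definition arclength_param (T : Type) (d : T -> T -> R) (g : R -> T) (a b u : R) : T :=
  g (real (Glb_Rbar (fun t => a <= t <= b /\ u <= arclength d g a t))).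

(* The integral of [rho ds] over [g] on [[a, b]]; infinite if [g] is not rectifiable. *)
Definition rho_length (T : Type) (d : T -> T -> R) (rho : T -> R) (g : R -> T) (a b : R) : Rbar :=
  match curve_length d g (closed_itv a b) with
  | Finite L => Finite (RInt (fun u => rho (arclength_param d g a b u)) 0 L)
  | _ => p_infty
  end.

Definition d_rho (T : Type) (d : T -> T -> R) (rho : T -> R) (x y : T) : R :=
  real (Glb_Rbar (fun r => exists (g : R -> T) (a b : R),
    is_curve d (closed_itv a b) g /\ joins g a b x y /\
    rho_length d rho g a b = Finite r)).

Definition GH_density (T : Type) (d : T -> T -> R) (M : R) (rho : T -> R) : Prop :=
  density d rho /\
  forall (x y : T) (g : R -> T) (a b : R),
    geodesic_joining d g a b x y ->
    Rbar_le (rho_length d rho g a b) (Finite (M * d_rho d rho x y)).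

Definition rho_eps (T : Type) (eps : R) (b : T -> R) (x : T) : R := exp (- eps * b x).

Definition d_eps (T : Type) (d : T -> T -> R) (eps : R) (b : T -> R) : T -> T -> R :=
  d_rho d (rho_eps eps b).

(* Points of the completion are represented by Cauchy sequences (two of them
   give the same point when their [completion_dist] is 0), points of the space
   by constant sequences. *)

Definition completion_dist (T : Type) (d : T -> T -> R) (u v : nat -> T) : R :=
  real (Lim_seq (fun n => d (u n) (v n))).

Definition metric_boundary (T : Type) (d : T -> T -> R) (u : nat -> T) : Prop :=
  cauchy_seq d u /\ forall x, ~ seq_limit d u x.

Definition boundary_dist (T : Type) (d : T -> T -> R) (x : T) : Rbar :=
  dist_to (completion_dist d) (fun _ => x) (metric_boundary d).

(* [g t] tends to the point [u] of the completion as [t] tends to the end [e] of [I]. *)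
Definition end_limit (T : Type) (d : T -> T -> R) (I : R -> Prop) (g : R -> T)
    (e : Rbar) (u : nat -> T) : Prop :=
  cauchy_seq d u /\
  filterlim (fun t => completion_dist d (fun _ => g t) u)
    (within I (Rbar_locally e)) (locally 0).

Definition uniform_curve (T : Type) (d : T -> T -> R) (A : R) (I : R -> Prop)
    (g : R -> T) : Prop :=
  is_curve d I g /\
  (is_finite (curve_length d g I) ->
     exists u v : nat -> T,
       end_limit d I g (left_end I) u /\
       end_limit d I g (right_end I) v /\
       Rbar_le (curve_length d g I) (Finite (A * completion_dist d u v))) /\
  (curve_length d g I = p_infty ->
     filterlim (fun p : R * R => d (g (fst p)) (g (snd p)))
       (filter_prod (within I (Rbar_locally (left_end I)))
                    (within I (Rbar_locally (right_end I))))
       (Rbar_locally p_infty)) /\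
  (forall t, I t ->
     Rbar_le (Rbar_min (curve_length d g (fun s => I s /\ s <= t))
                       (curve_length d g (fun s => I s /\ t <= s)))
             (Rbar_mult (Finite A) (boundary_dist d (g t)))).

Definition uniform_space (T : Type) (d : T -> T -> R) (A : R) : Prop :=
  is_metric d /\
  ~ metric_complete d /\
  forall x y : T, exists (g : R -> T) (a b : R),
    uniform_curve d A (closed_itv a b) g /\ joins g a b x y.

(* Main.v *)
(* Write D for the metric of the deformed space and rho = exp (- eps b).

   A function b with a basepoint is, on any finite set, nearly a distance function plus a
   constant.  So it is 1-Lipschitz, and thinness of the triangles spanned by two points of a
   geodesic g and a far point shows that at each t, either b (g u) >= b (g t) + (u - t) - C for
   all u >= t, or the mirrored bound holds for all s <= t.  One of the two halves of g then has
   rho-length at most exp (eps C) / eps * rho (g t).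

   On the other hand, the GH-inequality along the geodesic from x to y and the Lipschitz bound
   give D x y >= exp (- eps) / M * rho x * min 1 (d x y).  Hence, by completeness of d, a
   D-Cauchy sequence without D-limit stays at D-distance at least exp (- eps) / M * rho x from
   x.  The two bounds give condition (ii) of uniformity; condition (i) is the GH-inequality
   passed to the ends of the geodesic.

   Rough starlikeness serves only to produce a geodesic ray: along it (or its mirror image in a
   line) rho is integrable, so it runs into a boundary point, and D is incomplete. *)

Require Import Defs.
From Stdlib Require Import Lra Lia Classical IndefiniteDescription.

Set Implicit Arguments.
Unset Strict Implicit.
Unset Printing Implicit Defensive.

(** * Length of curves *)

Section Length.

Variables (T : Type) (d : T -> T -> R).
Hypothesis Hd : is_metric d.

Lemma metric_pos x y : 0 <= d x y.
Proof. destruct Hd as [H _]. specialize (H x y). lra. Qed.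

Lemma metric_sym x y : d x y = d y x.
Proof. apply Hd. Qed.

Lemma metric_refl x : d x x = 0.
Proof. apply Hd. reflexivity. Qed.

Lemma metric_tri x y z : d x z <= d x y + d y z.
Proof. apply Hd. Qed.

Lemma metric_eq0 x y : d x y <= 0 -> x = y.
Proof. intros H. apply Hd. pose proof (metric_pos x y). lra. Qed.

(* The subdivision sums of [curve_length], as an inductive predicate. *)
Inductive chain (g : R -> T) (I : R -> Prop) (a : R) : R -> R -> Prop :=
  | chain_point : I a -> chain g I a a 0
  | chain_step b c r : chain g I a b r -> b <= c -> I c ->
      chain g I a c (r + d (g b) (g c)).

Lemma chain_bounds g I a b r : chain g I a b r -> I a /\ I b /\ a <= b /\ 0 <= r.
Proof.
  induction 1 as [Ha|b c r H [Ia [Ib [Hab Hr]]] Hbc Ic].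
  - repeat split; auto; lra.
  - pose proof (metric_pos (g b) (g c)). repeat split; auto; lra.
Qed.

Lemma chain_partition g I a b r : chain g I a b r ->
  exists (n : nat) (t : nat -> R),
    (forall i, (i <= S n)%nat -> I (t i)) /\
    (forall i, (i <= n)%nat -> t i <= t (S i)) /\ t (S n) = b /\
    r = sum_n (fun i => d (g (t i)) (g (t (S i)))) n.
Proof.
  induction 1 as [Ha|b c r H [n [t [H1 [H2 [H3 H4]]]]] Hbc Ic].
  (* A subdivision in [curve_length] has at least one step, so a one-point chain becomes the
     constant subdivision, whose single term [d (g a) (g a)] vanishes. *)
  - exists 0%nat, (fun _ => a). rewrite sum_O, metric_refl. repeat split; auto. intros; apply Rle_refl.
  - exists (S n), (fun i => if Nat.leb i (S n) then t i else c). repeat split.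
    + intros i Hi. destruct (Nat.leb_spec i (S n)); auto.
    + intros i Hi. destruct (Nat.leb_spec i (S n)); destruct (Nat.leb_spec (S i) (S n)); try lia.
      * apply H2. lia.
      * replace i with (S n) by lia. now rewrite H3.
    + destruct (Nat.leb_spec (S (S n)) (S n)); auto; lia.
    + rewrite sum_Sn, H4. apply (f_equal2 Rplus).
      * apply sum_n_ext_loc. intros i Hi.
        destruct (Nat.leb_spec i (S n)); destruct (Nat.leb_spec (S i) (S n)); auto; lia.
      * destruct (Nat.leb_spec (S n) (S n)); destruct (Nat.leb_spec (S (S n)) (S n)); try lia.
        now rewrite H3.
Qed.

Lemma partition_chain g I n t :
  (forall i, (i <= S n)%nat -> I (t i)) ->
  (forall i, (i <= n)%nat -> t i <= t (S i)) ->
  chain g I (t 0%nat) (t (S n)) (sum_n (fun i => d (g (t i)) (g (t (S i)))) n).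
Proof.
  intros H1 H2. induction n as [|n IH].
  - rewrite sum_O. rewrite <- (Rplus_0_l (d _ _)).
    apply chain_step; auto. apply chain_point; auto.
  - rewrite sum_Sn. apply chain_step; auto.
Qed.

Lemma curve_length_le g I (L : Rbar) :
  (forall a b r, chain g I a b r -> Rbar_le r L) -> Rbar_le (curve_length d g I) L.
Proof.
  intros H. apply Lub_Rbar_correct. intros r [n [t [H1 [H2 H3]]]]. subst r.
  exact (H _ _ _ (partition_chain g H1 H2)).
Qed.

Lemma chain_le_curve_length g I a b r :
  chain g I a b r -> Rbar_le r (curve_length d g I).
Proof.
  intros H. apply Lub_Rbar_correct.
  destruct (chain_partition H) as [n [t [H1 [H2 [_ H3]]]]].
  exists n, t. auto.
Qed.

Lemma lt_curve_length g I (C : R) : Rbar_lt C (curve_length d g I) ->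
  exists a b r, chain g I a b r /\ C < r.
Proof.
  intros H. apply NNPP. intros N.
  apply (Rbar_lt_not_le _ _ H). apply curve_length_le.
  intros a b r Hc. simpl. apply Rnot_lt_le. intros Hr. apply N. now exists a, b, r.
Qed.

Lemma curve_length_finite g I t (C : R) : I t ->
  Rbar_le (curve_length d g I) C -> exists L, curve_length d g I = Finite L /\ 0 <= L.
Proof.
  intros It H. pose proof (chain_le_curve_length (chain_point g It)) as H0.
  destruct (curve_length d g I) as [L| |]; try contradiction. exists L. auto.
Qed.

Lemma chain_cat g I a b r b' c r' : chain g I a b r -> chain g I b' c r' -> b <= b' ->
  chain g I a c (r + d (g b) (g b') + r').
Proof.
  intros H H' Hb. induction H' as [Ib|c e r' H' IH Hc Ie].
  - rewrite Rplus_0_r. now apply chain_step.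
  - rewrite <- Rplus_assoc. now apply chain_step.
Qed.

Lemma chain_reparam g g' (I J : R -> Prop) psi a b r :
  (forall t, I t -> J (psi t) /\ g' (psi t) = g t) ->
  (forall s t, I s -> I t -> s <= t -> psi s <= psi t) ->
  chain g I a b r -> chain g' J (psi a) (psi b) r.
Proof.
  intros H1 H2. induction 1 as [Ia|b c r H IH Hbc Ic].
  - apply chain_point. now apply H1.
  - destruct (chain_bounds H) as [Ia [Ib _]].
    destruct (H1 b Ib) as [_ <-]. destruct (H1 c Ic) as [Jc <-].
    apply chain_step; auto.
Qed.

Lemma chain_reparam_anti g g' (I J : R -> Prop) psi a b r :
  (forall t, I t -> J (psi t) /\ g' (psi t) = g t) ->
  (forall s t, I s -> I t -> s <= t -> psi t <= psi s) ->
  chain g I a b r -> chain g' J (psi b) (psi a) r.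
Proof.
  intros H1 H2. induction 1 as [Ia|b c r H IH Hbc Ic].
  - apply chain_point. now apply H1.
  - destruct (chain_bounds H) as [Ia [Ib _]].
    destruct (H1 b Ib) as [Jb Eb]. destruct (H1 c Ic) as [Jc Ec].
    rewrite <- Eb, <- Ec, metric_sym.
    (* Under an order-reversing change of parameter the last step comes first, so it is put in front
       by concatenating a one-point chain with the reversed chain. *)
    replace (r + d (g' (psi c)) (g' (psi b))) with (0 + d (g' (psi c)) (g' (psi b)) + r) by ring.
    apply chain_cat with (b := psi c) (b' := psi b); auto. now apply chain_point.
Qed.

(** A monotone map carries subdivisions to subdivisions with the same sum, whether or not it is
    continuous or onto. Applied to a bijection and its inverse, this gives equality of lengths. *)
Lemma curve_length_reparam g g' (I J : R -> Prop) psi :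
  (forall t, I t -> J (psi t) /\ g' (psi t) = g t) ->
  (forall s t, I s -> I t -> s <= t -> psi s <= psi t) ->
  Rbar_le (curve_length d g I) (curve_length d g' J).
Proof.
  intros H1 H2. apply curve_length_le. intros a b r H.
  exact (chain_le_curve_length (chain_reparam H1 H2 H)).
Qed.

Lemma curve_length_reparam_anti g g' (I J : R -> Prop) psi :
  (forall t, I t -> J (psi t) /\ g' (psi t) = g t) ->
  (forall s t, I s -> I t -> s <= t -> psi t <= psi s) ->
  Rbar_le (curve_length d g I) (curve_length d g' J).
Proof.
  intros H1 H2. apply curve_length_le. intros a b r H.
  exact (chain_le_curve_length (chain_reparam_anti H1 H2 H)).
Qed.

Lemma curve_length_subset g (I J : R -> Prop) :
  (forall t, I t -> J t) -> Rbar_le (curve_length d g I) (curve_length d g J).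
Proof. intros H. apply curve_length_reparam with (psi := fun t => t); auto. Qed.

Lemma curve_length_translate g g' a b e :
  (forall t, a <= t <= b -> g' (t + e) = g t) ->
  curve_length d g' (closed_itv (a + e) (b + e)) = curve_length d g (closed_itv a b).
Proof.
  intros H. apply Rbar_le_antisym.
  - apply curve_length_reparam with (psi := fun t => t - e).
    + unfold closed_itv. intros t Ht. split; [lra|].
      rewrite <- H by lra. f_equal. ring.
    + intros; lra.
  - apply curve_length_reparam with (psi := fun t => t + e).
    + unfold closed_itv. intros t Ht. split; [lra|]. now apply H.
    + intros; lra.
Qed.

Lemma curve_length_reverse g a b :
  curve_length d (fun t => g (- t)) (closed_itv (- b) (- a)) =
  curve_length d g (closed_itv a b).
Proof.
  apply Rbar_le_antisym; apply curve_length_reparam_anti with (psi := Ropp); unfold closed_itv.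
  - intros t Ht. split; auto; lra.
  - intros; lra.
  - intros t Ht. split; [lra|f_equal; ring].
  - intros; lra.
Qed.

(** All points of the chain are clamped to [[a, c]] and to [[c, b]]. A step on the wrong side of [c]
    collapses to length 0, and a step across [c] is split there by the triangle inequality. *)
Lemma chain_split g a c b p q r : a <= c <= b -> chain g (closed_itv a b) p q r ->
  exists r1 r2, chain g (closed_itv a c) (Rmin p c) (Rmin q c) r1 /\
    chain g (closed_itv c b) (Rmax p c) (Rmax q c) r2 /\ r <= r1 + r2.
Proof.
  unfold closed_itv. intros Hc. induction 1 as [Hp|q q' r H [r1 [r2 [H1 [H2 H3]]]] Hq Hq'].
  - exists 0, 0. repeat split; try (apply chain_point); try lra.
    + unfold Rmin. destruct (Rle_dec p c); lra.
    + unfold Rmax. destruct (Rle_dec p c); lra.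
  - exists (r1 + d (g (Rmin q c)) (g (Rmin q' c))), (r2 + d (g (Rmax q c)) (g (Rmax q' c))).
    destruct (chain_bounds H) as [_ [Iq _]].
    repeat split.
    + apply chain_step; auto.
      * apply Rle_min_compat_r; auto.
      * unfold Rmin. destruct (Rle_dec q' c); lra.
    + apply chain_step; auto.
      * apply Rle_max_compat_r; auto.
      * unfold Rmax. destruct (Rle_dec q' c); lra.
    + unfold Rmin, Rmax. destruct (Rle_dec q c), (Rle_dec q' c); try lra.
      * rewrite (metric_refl (g c)). lra.
      * pose proof (metric_tri (g q) (g c) (g q')). lra.
      * rewrite (metric_refl (g c)). lra.
Qed.

Lemma curve_length_cat g a c b L1 L2 : a <= c <= b ->
  curve_length d g (closed_itv a c) = Finite L1 ->
  curve_length d g (closed_itv c b) = Finite L2 ->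
  curve_length d g (closed_itv a b) = Finite (L1 + L2).
Proof.
  intros Hc E1 E2. apply Rbar_le_antisym.
  - apply curve_length_le. intros p q r H.
    destruct (chain_split Hc H) as [r1 [r2 [H1 [H2 H3]]]].
    apply chain_le_curve_length in H1. apply chain_le_curve_length in H2.
    rewrite E1 in H1. rewrite E2 in H2. simpl in *. lra.
  - destruct (Rbar_le_lt_dec (L1 + L2) (curve_length d g (closed_itv a b))) as [H|H]; auto.
    exfalso. destruct (curve_length d g (closed_itv a b)) as [L| |] eqn:E; simpl in H.
    (* Half of the supposed deficit: two chains longer than [L1 - eta] and [L2 - eta] concatenate to
       one longer than [L]. *)
    + pose (eta := (L1 + L2 - L) / 2).
      destruct (@lt_curve_length g (closed_itv a c) (L1 - eta)) as [p1 [q1 [r1 [C1 R1]]]].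
      { rewrite E1. unfold eta. simpl. lra. }
      destruct (@lt_curve_length g (closed_itv c b) (L2 - eta)) as [p2 [q2 [r2 [C2 R2]]]].
      { rewrite E2. unfold eta. simpl. lra. }
      assert (D1 : chain g (closed_itv a b) p1 q1 r1).
      { apply chain_reparam with (psi := fun t => t) (3 := C1); unfold closed_itv; auto.
        intros t Ht. split; auto; lra. }
      assert (D2 : chain g (closed_itv a b) p2 q2 r2).
      { apply chain_reparam with (psi := fun t => t) (3 := C2); unfold closed_itv; auto.
        intros t Ht. split; auto; lra. }
      destruct (chain_bounds C1) as [_ [Q1 _]]. destruct (chain_bounds C2) as [Q2 _].
      unfold closed_itv in Q1, Q2.
      assert (Hq : q1 <= p2) by lra.
      pose proof (chain_le_curve_length (chain_cat D1 D2 Hq)) as H'.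
      rewrite E in H'. simpl in H'. pose proof (metric_pos (g q1) (g p2)).
      unfold eta in *. lra.
    + contradiction.
    + assert (Ia : closed_itv a b a) by (unfold closed_itv; lra).
      pose proof (chain_le_curve_length (chain_point g Ia)) as H'. now rewrite E in H'.
Qed.

Lemma curve_length_sub g a b p q L : a <= p -> p <= q -> q <= b ->
  curve_length d g (closed_itv a b) = Finite L ->
  exists L', curve_length d g (closed_itv p q) = Finite L' /\ 0 <= L'.
Proof.
  intros Hp Hpq Hq E. apply curve_length_finite with (t := p) (C := L).
  - unfold closed_itv; lra.
  - rewrite <- E. apply curve_length_subset. unfold closed_itv. intros; lra.
Qed.

Lemma curve_length_point g a : curve_length d g (closed_itv a a) = Finite 0.
Proof.
  assert (Ia : closed_itv a a a) by (unfold closed_itv; lra).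
  apply Rbar_le_antisym.
  - apply curve_length_le. induction 1 as [_|b' c r H IH Hbc Hc]; simpl; auto; try lra.
    destruct (chain_bounds H) as [_ [Hb _]]. unfold closed_itv in *.
    replace b' with c by lra. rewrite metric_refl. simpl in IH. lra.
  - exact (chain_le_curve_length (chain_point g Ia)).
Qed.

Lemma dist_le_curve_length g a b L : a <= b ->
  curve_length d g (closed_itv a b) = Finite L -> d (g a) (g b) <= L.
Proof.
  intros Hab E.
  assert (C : chain g (closed_itv a b) a b (0 + d (g a) (g b))).
  { apply chain_step; auto; [apply chain_point|]; unfold closed_itv; lra. }
  apply chain_le_curve_length in C. rewrite E in C. simpl in C. lra.
Qed.

End Length.

(** * Arclength parametrization *)

Lemma closed_itv_is_interval a b : a <= b -> is_interval (closed_itv a b).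
Proof. intros H. split; [exists a|]; unfold closed_itv; intros; lra. Qed.

Section Arclength.

Variables (T : Type) (d : T -> T -> R).
Hypothesis Hd : is_metric d.

Lemma is_curve_sub g a b p q : is_curve d (closed_itv a b) g ->
  a <= p -> p <= q -> q <= b -> is_curve d (closed_itv p q) g.
Proof.
  intros [_ H] Hp Hpq Hq. split; [now apply closed_itv_is_interval|].
  unfold closed_itv in *. intros t Ht e He. destruct (H t) with (eps := e) as [eta [H1 H2]]; auto; [lra|].
  exists eta. split; auto. intros s Hs. apply H2. lra.
Qed.

Lemma is_curve_reverse g a b : is_curve d (closed_itv a b) g ->
  is_curve d (closed_itv (- b) (- a)) (fun t => g (- t)).
Proof.
  intros [[[t0 H0] _] H]. split.
  { apply closed_itv_is_interval. unfold closed_itv in *. lra. }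
  unfold closed_itv in *. intros t Ht e He.
  destruct (H (- t)) with (eps := e) as [eta [H1 H2]]; auto; [lra|].
  exists eta. split; auto. intros s Hs Hst. apply H2; [lra|].
  replace (- s - - t) with (- (s - t)) by ring. now rewrite Rabs_Ropp.
Qed.

Lemma is_curve_translate g g' a b e : (forall t, a <= t <= b -> g' (t + e) = g t) ->
  is_curve d (closed_itv a b) g -> is_curve d (closed_itv (a + e) (b + e)) g'.
Proof.
  intros Hg [[[t0 H0] _] H]. split.
  { apply closed_itv_is_interval. unfold closed_itv in *. lra. }
  unfold closed_itv in *. intros t Ht eps He.
  destruct (H (t - e)) with (eps := eps) as [eta [H1 H2]]; auto; [lra|].
  exists eta. split; auto. intros s Hs Hst.
  replace s with (s - e + e) by ring. replace t with (t - e + e) by ring.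
  rewrite !Hg by lra. apply H2; [lra|]. now replace (s - e - (t - e)) with (s - t) by ring.
Qed.

Lemma is_curve_cat g a c b : a <= c <= b -> is_curve d (closed_itv a c) g ->
  is_curve d (closed_itv c b) g -> is_curve d (closed_itv a b) g.
Proof.
  intros Hc [_ H1] [_ H2]. split; [apply closed_itv_is_interval; lra|].
  unfold closed_itv in *. intros t Ht e He.
  destruct (Rtotal_order t c) as [Htc|[->|Htc]].
  - destruct (H1 t) with (eps := e) as [eta [E1 E2]]; auto; [lra|].
    exists (Rmin eta (c - t)). split; [apply Rmin_pos; lra|]. intros s Hs Hst.
    pose proof (Rmin_l eta (c - t)). pose proof (Rmin_r eta (c - t)).
    apply E2; [|lra]. destruct (Rabs_def2 _ _ Hst). lra.
  - destruct (H1 c) with (eps := e) as [eta1 [E1 E2]]; auto; [lra|].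
    destruct (H2 c) with (eps := e) as [eta2 [E3 E4]]; auto; [lra|].
    exists (Rmin eta1 eta2). split; [apply Rmin_pos; lra|]. intros s Hs Hst.
    pose proof (Rmin_l eta1 eta2). pose proof (Rmin_r eta1 eta2).
    destruct (Rle_dec s c); [apply E2|apply E4]; lra.
  - destruct (H2 t) with (eps := e) as [eta [E1 E2]]; auto; [lra|].
    exists (Rmin eta (t - c)). split; [apply Rmin_pos; lra|]. intros s Hs Hst.
    pose proof (Rmin_l eta (t - c)). pose proof (Rmin_r eta (t - c)).
    apply E2; [|lra]. destruct (Rabs_def2 _ _ Hst). lra.
Qed.

Lemma chain_truncate g I p q r : chain d g I p q r -> chain d g (closed_itv p q) p q r.
Proof.
  induction 1 as [Ip|b c r H IH Hbc Ic].
  - apply chain_point. unfold closed_itv; lra.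
  - destruct (chain_bounds Hd H) as [_ [_ [Hpb _]]].
    apply chain_step; auto; [|unfold closed_itv; lra].
    apply chain_reparam with (psi := fun t => t) (4 := IH); auto.
    unfold closed_itv. intros t Ht. split; auto; lra.
Qed.

(** The length of [[a, t]] is already approached on the intervals [[a, r]] with [r < t]: by
    continuity of [g], a chain that ends at [t] can end slightly earlier at an arbitrarily small
    loss. *)
Lemma curve_length_lsc g a t L u :
  is_curve d (closed_itv a t) g -> curve_length d g (closed_itv a t) = Finite L ->
  0 <= u -> (forall r, a <= r < t -> Rbar_le (curve_length d g (closed_itv a r)) u) ->
  L <= u.
Proof.
  intros [_ Hg] HL Hu H. apply Rnot_lt_le. intros HuL.
  destruct (lt_curve_length (d := d) (g := g) (I := closed_itv a t) (C := u)) as [p [q [r [C Hr]]]].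
  { now rewrite HL. }
  revert Hr. apply Rle_not_lt.
  induction C as [_|q q' r C IH Hqq Hq']; [lra|].
  destruct (chain_bounds Hd C) as [Ip [Iq [Hpq _]]].
  unfold closed_itv in Ip, Iq, Hq'.
  assert (Sub : forall p q r x, p <= q -> chain d g (closed_itv a t) p q r -> a <= p -> q <= x ->
            Rbar_le r (curve_length d g (closed_itv a x))).
  { intros p1 q1 r1 x H1 C1 H2 H3. apply chain_truncate in C1.
    eapply Rbar_le_trans; [apply (chain_le_curve_length Hd C1)|].
    apply curve_length_subset; auto. unfold closed_itv. intros; lra. }
  destruct (Rlt_dec q' t) as [Hlt|Hge].
  - assert (C' : chain d g (closed_itv a t) p q' (r + d (g q) (g q'))).
    { apply chain_step; auto. }
    pose proof (Rbar_le_trans _ _ _ (Sub p q' _ q' ltac:(lra) C' ltac:(lra) ltac:(lra)) (H q' ltac:(lra))) as H'.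
    exact H'.
  - assert (q' = t) by lra. subst q'.
    destruct (Rlt_dec q t) as [Hqt|Hqt].
    2:{ replace q with t in * by lra. rewrite metric_refl; auto. lra. }
    apply le_epsilon. intros e He.
    destruct (Hg t ltac:(unfold closed_itv; lra) e He) as [eta [E1 E2]].
    (* The new last point: not before [q], strictly before [t], and within [eta] of [t]. *)
    pose (c := Rmax q (t - eta / 2)).
    assert (Hc : q <= c < t /\ t - eta < c).
    { unfold c, Rmax. destruct (Rle_dec q (t - eta / 2)); lra. }
    assert (C' : chain d g (closed_itv a t) p c (r + d (g q) (g c))).
    { apply chain_step; auto; unfold closed_itv; lra. }
    pose proof (Rbar_le_trans _ _ _ (Sub p c _ c ltac:(lra) C' ltac:(lra) ltac:(lra)) (H c ltac:(lra))) as H'.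
    simpl in H'. pose proof (metric_tri Hd (g q) (g c) (g t)).
    assert (d (g c) (g t) < e).
    { apply E2; [unfold closed_itv; lra|]. apply Rabs_def1; lra. }
    lra.
Qed.

Lemma curve_length_lsc_right g t b L u :
  is_curve d (closed_itv t b) g -> curve_length d g (closed_itv t b) = Finite L ->
  0 <= u -> (forall r, t < r <= b -> Rbar_le (curve_length d g (closed_itv r b)) u) ->
  L <= u.
Proof.
  intros Hg HL Hu H.
  apply curve_length_lsc with (g := fun t => g (- t)) (a := - b) (t := - t); auto.
  - now apply is_curve_reverse.
  - rewrite curve_length_reverse; auto.
  - intros r Hr. replace r with (- - r) by ring. rewrite curve_length_reverse; auto.
    apply H. lra.
Qed.

Section Rectifiable.

Variables (g : R -> T) (a b L : R).
Hypothesis Hab : a <= b.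
Hypothesis Hg : is_curve d (closed_itv a b) g.
Hypothesis HL : curve_length d g (closed_itv a b) = Finite L.

Let s := arclength d g a.

Lemma arclength_spec t : a <= t <= b -> curve_length d g (closed_itv a t) = Finite (s t).
Proof.
  intros Ht. unfold s, arclength.
  destruct (curve_length_sub Hd (g := g) (a := a) (b := b) (p := a) (q := t) (L := L)) as [L' [E _]]; auto; try lra.
  now rewrite E.
Qed.

Lemma curve_length_arclength p q : a <= p -> p <= q -> q <= b ->
  curve_length d g (closed_itv p q) = Finite (s q - s p).
Proof.
  intros Hp Hpq Hq.
  destruct (curve_length_sub Hd (g := g) (a := a) (b := b) (p := p) (q := q) (L := L)) as [L' [E _]]; auto.
  rewrite E. f_equal.
  assert (E' := curve_length_cat Hd (conj Hp Hpq) (arclength_spec (conj Hp (Rle_trans _ _ _ Hpq Hq))) E).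
  rewrite arclength_spec in E' by lra. injection E'. lra.
Qed.

Lemma arclength_ends : s a = 0 /\ s b = L.
Proof.
  split.
  - unfold s, arclength. now rewrite curve_length_point.
  - unfold s, arclength. now rewrite HL.
Qed.

Lemma dist_le_arclength p q : a <= p -> p <= q -> q <= b -> d (g p) (g q) <= s q - s p.
Proof.
  intros. apply dist_le_curve_length with (g := g); auto. now apply curve_length_arclength.
Qed.

Lemma arclength_mono p q : a <= p -> p <= q -> q <= b -> s p <= s q.
Proof.
  intros. pose proof (dist_le_arclength (p := p) (q := q)). pose proof (metric_pos Hd (g p) (g q)).
  lra.
Qed.

Lemma arclength_bounds t : a <= t <= b -> 0 <= s t <= L.
Proof.
  intros Ht. destruct arclength_ends as [E1 E2].
  pose proof (@arclength_mono a t). pose proof (@arclength_mono t b). lra.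
Qed.

(** Both inequalities for the arclength at the infimum [tau] come from semicontinuity of length:
    before [tau] the arclength is below [u], and after [tau] at most [L - u] of the length
    remains. *)
Lemma arclength_first_time u : 0 <= u <= L ->
  exists tau, a <= tau <= b /\ s tau = u /\ arclength_param d g a b u = g tau.
Proof.
  intros Hu. destruct arclength_ends as [Ea Eb].
  unfold arclength_param. fold s.
  destruct (Glb_Rbar_correct (fun t => a <= t <= b /\ u <= s t)) as [G1 G2].
  set (l := Glb_Rbar (fun t => a <= t <= b /\ u <= s t)) in *.
  assert (Hla : Rbar_le a l) by (apply G2; intros x [Hx _]; simpl; lra).
  assert (Hlb : Rbar_le l b) by (apply G1; split; lra).
  destruct l as [tau| |] eqn:El; simpl in Hla, Hlb; try contradiction.
  exists tau. simpl. split; [lra|]. split; [|reflexivity].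
  apply Rle_antisym.
  - apply curve_length_lsc with (g := g) (a := a) (t := tau); try lra.
    + apply is_curve_sub with (a := a) (b := b); auto; lra.
    + apply arclength_spec; lra.
    + intros r Hr. rewrite arclength_spec by lra. simpl.
      apply Rnot_lt_le. intros Hs.
      assert (Rbar_le tau r) by (apply G1; split; lra). simpl in *. lra.
  (* In terms of remaining lengths, the bound from the right has the form required by
     [curve_length_lsc_right]. *)
  - assert (L - s tau <= L - u); [|lra].
    apply curve_length_lsc_right with (g := g) (t := tau) (b := b); try lra.
    + apply is_curve_sub with (a := a) (b := b); auto; lra.
    + rewrite curve_length_arclength, Eb by lra. reflexivity.
    + intros r Hr. rewrite curve_length_arclength, Eb by lra. simpl.
      cut (u <= s r); [lra|].
      apply NNPP. intros Hs.
      assert (Hrt : Rbar_le r tau).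
      { apply G2. intros x [Hx1 Hx2]. simpl. apply Rnot_lt_le. intros Hxr.
        pose proof (@arclength_mono x r). lra. }
      simpl in Hrt. lra.
Qed.

(** The first time [tau] with arclength [s t] may differ from [t], but the curve between the two
    times has length 0, so [g tau = g t]. *)
Lemma arclength_param_arclength t : a <= t <= b -> arclength_param d g a b (s t) = g t.
Proof.
  intros Ht. destruct (arclength_first_time (arclength_bounds Ht)) as [tau [H1 [H2 ->]]].
  apply (metric_eq0 Hd). destruct (Rle_dec t tau).
  - rewrite metric_sym; auto. pose proof (@dist_le_arclength t tau). lra.
  - pose proof (@dist_le_arclength tau t). lra.
Qed.

(** This makes the integrand of [rho_length] continuous on [[0, L]], hence integrable. *)
Lemma arclength_param_lipschitz u v : 0 <= u <= L -> 0 <= v <= L ->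
  d (arclength_param d g a b u) (arclength_param d g a b v) <= Rabs (u - v).
Proof.
  intros Hu Hv.
  destruct (arclength_first_time Hu) as [t1 [H1 [E1 ->]]].
  destruct (arclength_first_time Hv) as [t2 [H2 [E2 ->]]].
  destruct (Rle_dec t1 t2).
  - pose proof (@dist_le_arclength t1 t2). rewrite Rabs_minus_sym.
    pose proof (Rle_abs (v - u)). lra.
  - rewrite metric_sym; auto. pose proof (@dist_le_arclength t2 t1).
    pose proof (Rle_abs (u - v)). lra.
Qed.

End Rectifiable.
End Arclength.

(** * The conformal metric *)

Lemma ex_RInt_rel_continuous (f : R -> R) a b : a <= b ->
  (forall t, a <= t <= b -> forall e, 0 < e -> exists eta, 0 < eta /\
     forall s, a <= s <= b -> Rabs (s - t) < eta -> Rabs (f s - f t) < e) ->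
  ex_RInt f a b.
Proof.
  intros Hab Hf.
  (* Precomposition with the 1-Lipschitz retraction onto [[a, b]] turns continuity relative to
     [[a, b]] into continuity on the whole line without changing the integral. *)
  pose (clamp := fun x => Rmax a (Rmin b x)).
  assert (Hc : forall x, a <= clamp x <= b).
  { intros x. unfold clamp, Rmax, Rmin.
    destruct (Rle_dec b x); destruct (Rle_dec _ _); lra. }
  assert (Hl : forall x y, Rabs (clamp x - clamp y) <= Rabs (x - y)).
  { intros x y. unfold clamp, Rmax, Rmin, Rabs.
    destruct (Rle_dec b x), (Rle_dec b y); repeat destruct (Rle_dec _ _);
      repeat destruct (Rcase_abs _); lra. }
  apply ex_RInt_ext with (fun x => f (clamp x)).
  { rewrite Rmin_left, Rmax_right by lra. intros x Hx. f_equal.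
    unfold clamp. rewrite Rmin_right, Rmax_right; lra. }
  apply (ex_RInt_continuous (V := R_CompleteNormedModule)). intros z _.
  apply filterlim_locally. intros [e He]. simpl.
  destruct (Hf (clamp z) (Hc z) e He) as [eta [H1 H2]].
  exists (mkposreal eta H1). intros y Hy.
  apply H2; auto. eapply Rle_lt_trans; [apply Hl|exact Hy].
Qed.

Section ConformalLength.

Variables (T : Type) (d : T -> T -> R) (rho : T -> R).
Hypothesis Hd : is_metric d.
Hypothesis Hrho : density d rho.

Lemma ex_RInt_density h a b : a <= b ->
  (forall s t, a <= s <= b -> a <= t <= b -> d (h s) (h t) <= Rabs (s - t)) ->
  ex_RInt (fun u => rho (h u)) a b.
Proof.
  intros Hab Hh. apply ex_RInt_rel_continuous; auto. intros t Ht e He.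
  destruct Hrho as [_ Hc]. destruct (Hc (h t) e He) as [eta [H1 H2]].
  exists eta. split; auto. intros s Hs Hst. apply H2.
  eapply Rle_lt_trans; [apply Hh; auto|]. now rewrite Rabs_minus_sym.
Qed.

Lemma ex_RInt_arclength_param g a b L : a <= b -> is_curve d (closed_itv a b) g ->
  curve_length d g (closed_itv a b) = Finite L ->
  ex_RInt (fun u => rho (arclength_param d g a b u)) 0 L.
Proof.
  intros Hab Hg HL.
  assert (0 <= L).
  { pose proof (arclength_bounds Hd HL (t := b)). lra. }
  apply ex_RInt_density; auto.
  intros s t Hs Ht. now apply arclength_param_lipschitz with (L := L).
Qed.

Lemma rho_length_finite g a b r : rho_length d rho g a b = Finite r ->
  exists L, curve_length d g (closed_itv a b) = Finite L.
Proof.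
  unfold rho_length. destruct (curve_length d g (closed_itv a b)) as [L| |]; try discriminate.
  now exists L.
Qed.

Lemma rho_length_nonneg g a b r : a <= b -> is_curve d (closed_itv a b) g ->
  rho_length d rho g a b = Finite r -> 0 <= r.
Proof.
  intros Hab Hg Hr. destruct (rho_length_finite Hr) as [L HL].
  unfold rho_length in Hr. rewrite HL in Hr. injection Hr as <-.
  apply RInt_ge_0.
  - pose proof (arclength_bounds Hd HL (t := b)). lra.
  - now apply ex_RInt_arclength_param.
  - intros x _. apply Rlt_le, Hrho.
Qed.

(* The arclength is onto [[0, L]], so [f] below agrees on it with the integrand of
   [rho_length]. *)
Lemma rho_length_eq g a b L f : a <= b -> is_curve d (closed_itv a b) g ->
  curve_length d g (closed_itv a b) = Finite L ->
  (forall t, a <= t <= b -> f (arclength d g a t) = rho (g t)) ->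
  rho_length d rho g a b = Finite (RInt f 0 L).
Proof.
  intros Hab Hg HL Hf. unfold rho_length. rewrite HL. f_equal.
  assert (0 <= L).
  { pose proof (arclength_bounds Hd HL (t := b)). lra. }
  apply RInt_ext. rewrite Rmin_left, Rmax_right by lra. intros u Hu.
  destruct (arclength_first_time Hd Hab Hg HL (u := u)) as [t [H1 [<- ->]]]; [lra|].
  symmetry. auto.
Qed.

Lemma rho_length_translate g g' a b e : (forall t, a <= t <= b -> g' (t + e) = g t) ->
  is_curve d (closed_itv a b) g -> a <= b ->
  rho_length d rho g' (a + e) (b + e) = rho_length d rho g a b.
Proof.
  intros Hgg Hg Hab.
  pose proof (curve_length_translate Hd Hgg) as EL.
  destruct (curve_length d g (closed_itv a b)) as [L| |] eqn:HL;
    [|unfold rho_length; now rewrite EL, HL..].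
  rewrite (@rho_length_eq g' (a + e) (b + e) L
            (fun u => rho (arclength_param d g a b u))); auto; try lra.
  - unfold rho_length. now rewrite HL.
  - now apply is_curve_translate with g.
  - intros t Ht. replace t with (t - e + e) by ring. rewrite Hgg by lra.
    replace (arclength d g' (a + e) (t - e + e)) with (arclength d g a (t - e)).
    2:{ unfold arclength. f_equal. symmetry. apply (curve_length_translate Hd).
        intros s Hs. apply Hgg. lra. }
    now rewrite (arclength_param_arclength Hd Hab Hg HL) by lra.
Qed.

Lemma rho_length_reverse g a b : is_curve d (closed_itv a b) g -> a <= b ->
  rho_length d rho (fun t => g (- t)) (- b) (- a) = rho_length d rho g a b.
Proof.
  intros Hg Hab. pose proof (curve_length_reverse Hd g a b) as EL.
  destruct (curve_length d g (closed_itv a b)) as [L| |] eqn:HL;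
    [|unfold rho_length; now rewrite EL, HL..].
  rewrite (@rho_length_eq (fun t => g (- t)) (- b) (- a) L
            (fun u => rho (arclength_param d g a b (L - u)))); auto; try lra.
  - unfold rho_length. rewrite HL. f_equal.
    pose proof (ex_RInt_arclength_param Hab Hg HL) as Hex.
    set (F := fun u => rho (arclength_param d g a b u)) in *.
    change (RInt (fun u => F (L - u)) 0 L = RInt F 0 L).
    (* Substitution [u -> L - u]: the factor -1 cancels against the exchanged limits of
       integration. *)
    assert (E := RInt_comp_lin F (-1) L 0 L).
    replace (-1 * 0 + L) with L in E by ring. replace (-1 * L + L) with 0 in E by ring.
    specialize (E (ex_RInt_swap _ _ _ Hex)).
    rewrite <- (opp_RInt_swap F 0 L Hex) in E.
    assert (Ex : ex_RInt (fun u => F (L - u)) 0 L).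
    { apply ex_RInt_ext with (fun y => opp (scal (-1) (F (-1 * y + L)))).
      - intros x _. unfold opp, scal; simpl. unfold mult; simpl.
        replace (-1 * x + L) with (L - x) by ring. ring.
      - apply (ex_RInt_opp (V := R_NormedModule)). apply (ex_RInt_comp_lin F).
        replace (-1 * 0 + L) with L by ring. replace (-1 * L + L) with 0 by ring.
        now apply ex_RInt_swap. }
    rewrite (RInt_ext _ (fun u => scal (-1) (F (L - u)))) in E.
    2:{ intros x _. do 2 f_equal. ring. }
    assert (E' := eq_trans (eq_sym (RInt_scal _ _ _ (-1) Ex)) E). clear E. rename E' into E.
    unfold opp, scal in E; simpl in E. unfold mult in E; simpl in E. lra.
  - now apply is_curve_reverse.
  - intros t Ht. rewrite <- (arclength_param_arclength Hd Hab Hg HL (t := - t)) by lra.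
    do 2 f_equal.
    assert (arclength d (fun t => g (- t)) (- b) t = L - arclength d g a (- t)); [|lra].
    unfold arclength at 1. replace t with (- - t) at 1 by ring.
    rewrite curve_length_reverse, (curve_length_arclength Hd HL) by (auto; lra). simpl.
    now rewrite (proj2 (arclength_ends Hd HL)).
Qed.

(** The integrand over [[a, b]] is glued from those of the two pieces at arclength [L1], the length
    of the first piece. Chasles' relation and a translation by [L1] then give the sum. *)
Lemma rho_length_cat g a c b r1 r2 : a <= c <= b -> is_curve d (closed_itv a b) g ->
  rho_length d rho g a c = Finite r1 -> rho_length d rho g c b = Finite r2 ->
  rho_length d rho g a b = Finite (r1 + r2).
Proof.
  intros [Hac Hcb] Hg H1 H2. assert (Hab : a <= b) by lra.
  destruct (rho_length_finite H1) as [L1 E1]. destruct (rho_length_finite H2) as [L2 E2].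
  assert (E := curve_length_cat Hd (conj Hac Hcb) E1 E2).
  assert (C1 : is_curve d (closed_itv a c) g) by (apply is_curve_sub with (2 := Rle_refl a) (b := b); auto).
  assert (C2 : is_curve d (closed_itv c b) g) by (apply is_curve_sub with (1 := Hg); auto; lra).
  pose proof (ex_RInt_arclength_param Hac C1 E1) as X1.
  pose proof (ex_RInt_arclength_param Hcb C2 E2) as X2.
  assert (P1 := arclength_bounds Hd E1 (t := c)).
  assert (P2 := arclength_bounds Hd E2 (t := b)).
  unfold rho_length in H1, H2. rewrite E1 in H1. rewrite E2 in H2.
  injection H1 as <-. injection H2 as <-.
  set (F1 := fun u => rho (arclength_param d g a c u)) in *.
  set (F2 := fun u => rho (arclength_param d g c b u)) in *.
  rewrite (@rho_length_eq g a b (L1 + L2)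
             (fun u => if Rle_dec u L1 then F1 u else F2 (u - L1))); auto.
  - f_equal.
    assert (Y1 : ex_RInt (fun u => if Rle_dec u L1 then F1 u else F2 (u - L1)) 0 L1).
    { apply ex_RInt_ext with F1; auto. rewrite Rmin_left, Rmax_right by lra. intros x Hx.
      destruct (Rle_dec x L1); auto; lra. }
    assert (Z : ex_RInt (fun y => scal 1 (F2 (1 * y + - L1))) L1 (L1 + L2)).
    { apply (ex_RInt_comp_lin F2). replace (1 * L1 + - L1) with 0 by ring.
      now replace (1 * (L1 + L2) + - L1) with L2 by ring. }
    assert (Eq : forall x, Rmin L1 (L1 + L2) < x < Rmax L1 (L1 + L2) ->
        scal 1 (F2 (1 * x + - L1)) = (if Rle_dec x L1 then F1 x else F2 (x - L1))).
    { rewrite Rmin_left, Rmax_right by lra. intros x Hx.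
      destruct (Rle_dec x L1); [lra|]. unfold scal; simpl; unfold mult; simpl.
      rewrite Rmult_1_l. f_equal. ring. }
    assert (Y2 := ex_RInt_ext _ _ _ _ Eq Z).
    refine (eq_trans (eq_sym (RInt_Chasles (V := R_CompleteNormedModule) _ 0 L1 (L1 + L2) Y1 Y2)) _).
    apply (f_equal2 Rplus).
    + apply RInt_ext. rewrite Rmin_left, Rmax_right by lra. intros x Hx.
      destruct (Rle_dec x L1); auto; lra.
    + refine (eq_trans (eq_sym (RInt_ext (V := R_CompleteNormedModule) _ _ _ _ Eq)) _).
      rewrite (RInt_comp_lin F2).
      * f_equal; ring.
      * replace (1 * L1 + - L1) with 0 by ring.
        now replace (1 * (L1 + L2) + - L1) with L2 by ring.
  - intros t Ht. destruct (Rle_dec t c) as [Htc|Htc].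
    + pose proof (arclength_bounds Hd E1 (t := t)).
      destruct (Rle_dec (arclength d g a t) L1); [|lra].
      unfold F1. now rewrite (arclength_param_arclength Hd Hac C1 E1) by lra.
    + assert (Et : arclength d g a t = L1 + arclength d g c t).
      { unfold arclength at 1.
        assert (Hct : a <= c <= t) by lra. assert (Htb : c <= t <= b) by lra.
        now rewrite (curve_length_cat Hd Hct E1 (arclength_spec Hd E2 Htb)). }
      pose proof (arclength_bounds Hd E2 (t := t)).
      destruct (Rle_dec (arclength d g a t) L1).
      (* Here [t] lies after [c], yet no arclength is gained between them, so the curve stands still
         and the value at [c] can be used. *)
      * assert (g t = g c) as ->.
        { symmetry. apply (metric_eq0 Hd).
          pose proof (dist_le_arclength Hd E2 (p := c) (q := t)).
          destruct (arclength_ends Hd E2). lra. }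
        replace (arclength d g a t) with (arclength d g a c).
        -- unfold F1. now rewrite (arclength_param_arclength Hd Hac C1 E1) by lra.
        -- rewrite (proj2 (arclength_ends Hd E1)). lra.
      * unfold F2. replace (arclength d g a t - L1) with (arclength d g c t) by lra.
        now rewrite (arclength_param_arclength Hd Hcb C2 E2) by lra.
Qed.

(** * Length and rho-length of geodesics *)

Lemma chain_geodesic g I a b r : geodesic d I g -> chain d g I a b r -> r = b - a.
Proof.
  intros [_ Hg]. induction 1 as [_|b c r H IH Hbc Ic]; [ring|].
  destruct (chain_bounds Hd H) as [_ [Ib _]].
  rewrite IH, (Hg b c Ib Ic), Rabs_left1; lra.
Qed.

Lemma geodesic_sub g I a b : geodesic d I g -> I a -> I b -> a <= b ->
  geodesic d (closed_itv a b) g.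
Proof.
  intros [[_ HI] Hg] Ia Ib Hab. split; [now apply closed_itv_is_interval|].
  unfold closed_itv. intros s t Hs Ht. apply Hg; [apply HI with a b|apply HI with a b]; auto.
Qed.

Lemma geodesic_is_curve g I : geodesic d I g -> is_curve d I g.
Proof.
  intros [HI Hg]. split; auto. intros t It e He. exists e. split; auto.
  intros s Is Hs. now rewrite Hg.
Qed.

Lemma curve_length_geodesic g a b : a <= b -> geodesic d (closed_itv a b) g ->
  curve_length d g (closed_itv a b) = Finite (b - a).
Proof.
  intros Hab Hg. apply Rbar_le_antisym.
  - apply curve_length_le. intros p q r C. rewrite (chain_geodesic Hg C).
    destruct (chain_bounds Hd C) as [Ip [Iq _]]. unfold closed_itv in *. simpl. lra.
  - assert (C : chain d g (closed_itv a b) a b (0 + d (g a) (g b))).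
    { apply chain_step; auto; [apply chain_point|]; unfold closed_itv; lra. }
    pose proof (chain_le_curve_length Hd C) as H. now rewrite (chain_geodesic Hg C) in H.
Qed.

Lemma ex_RInt_geodesic g a b : a <= b -> geodesic d (closed_itv a b) g ->
  ex_RInt (fun t => rho (g t)) a b.
Proof.
  intros Hab [_ Hg]. apply ex_RInt_density; auto. intros s t Hs Ht. rewrite Hg; auto. lra.
Qed.

Lemma rho_length_geodesic g a b : a <= b -> geodesic d (closed_itv a b) g ->
  rho_length d rho g a b = Finite (RInt (fun t => rho (g t)) a b).
Proof.
  intros Hab Hg.
  (* The arclength at time [t] is [t - a]; the integrand is written in the form of an affine
     substitution for [RInt_comp_lin]. *)
  rewrite (@rho_length_eq g a b (b - a) (fun u => scal 1 (rho (g (1 * u + a))))); auto.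
  - rewrite (RInt_comp_lin (fun t => rho (g t))).
    + do 2 f_equal; ring.
    + replace (1 * 0 + a) with a by ring. replace (1 * (b - a) + a) with b by ring.
      now apply ex_RInt_geodesic.
  - now apply geodesic_is_curve.
  - now apply curve_length_geodesic.
  - intros t Ht. unfold arclength. rewrite curve_length_geodesic; [|lra|].
    + simpl. unfold scal; simpl; unfold mult; simpl. rewrite Rmult_1_l. do 2 f_equal. ring.
    + apply geodesic_sub with (1 := Hg); unfold closed_itv; lra.
Qed.

(** * Symmetry and triangle inequality for the deformed distance *)

Hypothesis Hgeo : geodesic_space d.

(** [d_rho] is the real part of an extended infimum. Geodesics give a finite competitor and 0 is a
    lower bound, so the infimum is finite and [real] loses nothing. *)
Lemma d_rho_spec x y :
  (forall g a b r, is_curve d (closed_itv a b) g -> joins g a b x y ->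
     rho_length d rho g a b = Finite r -> 0 <= d_rho d rho x y <= r) /\
  (forall e, 0 < e -> exists g a b r, is_curve d (closed_itv a b) g /\ joins g a b x y /\
     rho_length d rho g a b = Finite r /\ r < d_rho d rho x y + e).
Proof.
  unfold d_rho.
  set (E := fun r => exists g a b, is_curve d (closed_itv a b) g /\ joins g a b x y /\
      rho_length d rho g a b = Finite r).
  destruct (Glb_Rbar_correct E) as [H1 H2].
  assert (HE : exists r, E r).
  { destruct (Hgeo x y) as [g [a [b [Hg Hj]]]].
    exists (RInt (fun t => rho (g t)) a b), g, a, b. split; [now apply geodesic_is_curve|].
    split; auto. apply rho_length_geodesic; auto. apply Hj. }
  assert (H0 : Rbar_le 0 (Glb_Rbar E)).
  { apply H2. intros r [g [a [b [Hg [Hj Hr]]]]]. simpl.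
    eapply rho_length_nonneg; eauto. apply Hj. }
  destruct HE as [r0 HE]. pose proof (H1 r0 HE) as H3.
  destruct (Glb_Rbar E) as [m| |]; try contradiction. simpl real. simpl in H0. split.
  - intros g a b r Hg Hj Hr. split; auto. apply (H1 r). exists g, a, b. auto.
  - intros e He. apply NNPP. intros N.
    assert (Rbar_le (m + e) m); [|simpl in *; lra].
    apply H2. intros r [g [a [b [Hg [Hj Hr]]]]]. simpl. apply Rnot_lt_le. intros Hlt.
    apply N. exists g, a, b, r. auto.
Qed.

Lemma d_rho_nonneg x y : 0 <= d_rho d rho x y.
Proof.
  destruct (d_rho_spec x y) as [H1 H2].
  destruct (H2 1) as [g [a [b [r [Hg [Hj [Hr _]]]]]]]; [lra|].
  apply (H1 g a b r Hg Hj Hr).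
Qed.

Lemma d_rho_le_geodesic g a b : a <= b -> geodesic d (closed_itv a b) g ->
  d_rho d rho (g a) (g b) <= RInt (fun t => rho (g t)) a b.
Proof.
  intros Hab Hg. apply (d_rho_spec (g a) (g b)) with g a b.
  - now apply geodesic_is_curve.
  - repeat split; auto.
  - now apply rho_length_geodesic.
Qed.

Lemma d_rho_sym x y : d_rho d rho x y = d_rho d rho y x.
Proof.
  assert (H : forall x y, d_rho d rho y x <= d_rho d rho x y);
    [|apply Rle_antisym; apply H].
  clear x y. intros x y. apply le_epsilon. intros e He.
  destruct (proj2 (d_rho_spec x y) e He) as [g [a [b [r [Hg [[Hab [<- <-]] [Hr Hlt]]]]]]].
  apply Rle_trans with r; [|lra].
  apply (d_rho_spec (g b) (g a)) with (fun t => g (- t)) (- b) (- a).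
  - now apply is_curve_reverse.
  - repeat split; [lra|f_equal; ring..].
  - now rewrite rho_length_reverse.
Qed.

Lemma d_rho_tri x y z : d_rho d rho x z <= d_rho d rho x y + d_rho d rho y z.
Proof.
  apply le_epsilon. intros e He.
  destruct (proj2 (d_rho_spec x y) (e / 2) ltac:(lra))
    as [g1 [a1 [b1 [r1 [Hg1 [[Hab1 [<- <-]] [Hr1 Hlt1]]]]]]].
  destruct (proj2 (d_rho_spec (g1 b1) z) (e / 2) ltac:(lra))
    as [g2 [a2 [b2 [r2 [Hg2 [[Hab2 [E2 <-]] [Hr2 Hlt2]]]]]]].
  apply Rle_trans with (r1 + r2); [|lra].
  (* The shift of parameter after which the second curve starts at the time [b1] at which the first
     one ends. *)
  pose (k := b1 - a2).
  pose (h := fun t => if Rle_dec t b1 then g1 t else g2 (t - k)).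
  assert (h1 : forall t, a1 <= t <= b1 -> h (t + 0) = g1 t).
  { intros t Ht. unfold h. rewrite Rplus_0_r. destruct (Rle_dec t b1); auto; lra. }
  assert (h2 : forall t, a2 <= t <= b2 -> h (t + k) = g2 t).
  { intros t Ht. unfold h. replace (t + k - k) with t by ring. destruct (Rle_dec (t + k) b1); auto.
    replace t with a2 by (unfold k in *; lra). rewrite E2. f_equal. unfold k; ring. }
  assert (I1 := is_curve_translate h1 Hg1). assert (I2 := is_curve_translate h2 Hg2).
  assert (J1 := rho_length_translate h1 Hg1 Hab1).
  assert (J2 := rho_length_translate h2 Hg2 Hab2).
  rewrite !Rplus_0_r in *. replace (a2 + k) with b1 in * by (unfold k; ring).
  assert (Hb : a1 <= b1 <= b2 + k) by (unfold k; lra).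
  assert (I := is_curve_cat Hb I1 I2).
  apply (d_rho_spec (g1 a1) (g2 b2)) with h a1 (b2 + k); auto.
  - repeat split; [lra| |].
    + rewrite <- (Rplus_0_r a1) at 1. apply h1. lra.
    + apply h2. lra.
  - apply rho_length_cat with b1; auto; congruence.
Qed.

End ConformalLength.

(** * Busemann functions on geodesics *)

Section Hyperbolic.

Variables (T : Type) (d : T -> T -> R).
Hypothesis Hd : is_metric d.

(** The infimum defining [dist_to] need not be attained, whence the slack [e]. *)
Lemma dist_to_lt x S (r e : R) : 0 < e -> Rbar_le (dist_to d x S) r ->
  exists y, S y /\ d x y < r + e.
Proof.
  intros He H. apply NNPP. intros N.
  assert (Rbar_le (r + e) (dist_to d x S)) as H'.
  { apply Glb_Rbar_correct. intros z [y [Sy ->]]. simpl. apply Rnot_lt_le. intros Hlt.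
    apply N. now exists y. }
  pose proof (Rbar_le_trans _ _ _ H' H). simpl in *. lra.
Qed.

(** By the triangle inequality [d (g t) x - t] is nonincreasing in [t] and bounded below by
    [- d (g 0) x], so it converges to its infimum. *)
Lemma busemann_limit g x : geodesic_ray d g ->
  forall e, 0 < e -> exists N, forall t, N <= t ->
    Rabs (d (g t) x - t - busemann d g x) < e.
Proof.
  intros [_ Hg]. unfold half_line in Hg.
  pose (phi := fun t => d (g t) x - t).
  assert (Hdec : forall s t, 0 <= s -> s <= t -> phi t <= phi s).
  { intros s t Hs Hst. unfold phi. pose proof (metric_tri Hd (g t) (g s) x).
    rewrite (Hg t s) in H by lra. rewrite Rabs_right in H by lra. lra. }
  assert (Hlow : forall t, 0 <= t -> - d (g 0) x <= phi t).
  { intros t Ht. unfold phi. pose proof (metric_tri Hd (g t) x (g 0)).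
    rewrite (Hg t 0) in H by lra. rewrite Rabs_right in H by lra.
    rewrite (metric_sym Hd x) in H. lra. }
  pose (E := fun r => exists t, 0 <= t /\ r = phi t).
  destruct (Glb_Rbar_correct E) as [G1 G2].
  assert (H1 : Rbar_le (- d (g 0) x) (Glb_Rbar E)).
  { apply G2. intros r [t [Ht ->]]. simpl. auto. }
  assert (H2 : Rbar_le (Glb_Rbar E) (phi 0)).
  { apply G1. exists 0. split; auto. lra. }
  destruct (Glb_Rbar E) as [m| |]; try contradiction.
  assert (Hm : forall e, 0 < e -> exists N, forall t, N <= t -> Rabs (phi t - m) < e).
  { intros e He. assert (exists t, 0 <= t /\ phi t < m + e) as [N [HN1 HN2]].
    { apply NNPP. intros N.
      assert (Rbar_le (m + e) m) as H; [|simpl in H; lra].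
      apply G2. intros r [t [Ht ->]]. simpl. apply Rnot_lt_le. intros Hlt. apply N. now exists t. }
    exists N. intros t Ht. pose proof (Hdec N t HN1 Ht).
    assert (Rbar_le m (phi t)) as H3 by (apply G1; exists t; split; [lra|auto]).
    simpl in H3. apply Rabs_def1; lra. }
  assert (L : is_lim phi p_infty m).
  { apply is_lim_spec. intros [e He]. destruct (Hm e He) as [N HN].
    exists N. intros t Ht. simpl. apply HN. lra. }
  unfold busemann. apply is_lim_unique in L. unfold phi in L. rewrite L. exact Hm.
Qed.

Variables (b : T -> R) (w : basepoint T).
Hypothesis Hb : has_basepoint d b w.

(** This treats both kinds of basepoint at once: [p] is the basepoint itself if it is an inner
    point, and a point far out on the defining ray otherwise. Three points are what the triangle
    argument below compares. *)
Lemma basepoint_approx x y z e : 0 < e -> exists p c,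
  Rabs (d x p + c - b x) < e /\ Rabs (d y p + c - b y) < e /\ Rabs (d z p + c - b z) < e.
Proof.
  intros He. destruct w as [p|om].
  - destruct Hb as [c Hc]. exists p, c. rewrite !Hc.
    repeat split; rewrite Rminus_diag, Rabs_R0; auto.
  - destruct Hb as [g [c [Hg [Hc _]]]].
    destruct (busemann_limit x Hg He) as [N1 H1].
    destruct (busemann_limit y Hg He) as [N2 H2].
    destruct (busemann_limit z Hg He) as [N3 H3].
    pose (t := Rmax N1 (Rmax N2 N3)).
    pose proof (Rmax_l N1 (Rmax N2 N3)). pose proof (Rmax_r N1 (Rmax N2 N3)).
    pose proof (Rmax_l N2 N3). pose proof (Rmax_r N2 N3).
    exists (g t), (- t + c). rewrite !Hc, !(metric_sym Hd _ (g t)).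
    specialize (H1 t ltac:(unfold t; lra)). specialize (H2 t ltac:(unfold t; lra)).
    specialize (H3 t ltac:(unfold t; lra)).
    repeat split.
    + replace (_ - _) with (d (g t) x - t - busemann d g x) by ring; auto.
    + replace (_ - _) with (d (g t) y - t - busemann d g y) by ring; auto.
    + replace (_ - _) with (d (g t) z - t - busemann d g z) by ring; auto.
Qed.

Lemma basepoint_lipschitz x y : Rabs (b x - b y) <= d x y.
Proof.
  apply le_epsilon. intros e He.
  destruct (@basepoint_approx x y x (e / 2)) as [p [c [H1 [H2 _]]]]; [lra|].
  apply Rabs_def2 in H1. apply Rabs_def2 in H2.
  pose proof (metric_tri Hd x y p). pose proof (metric_tri Hd y x p).
  rewrite (metric_sym Hd y x) in *. apply Rabs_le. lra.
Qed.

Variable delta : R.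
Hypothesis Hgeo : geodesic_space d.
Hypothesis Hhyp : delta_hyperbolic d delta.

Lemma geodesic_dist_add g a c x y q : geodesic_joining d g a c x y ->
  trace g (closed_itv a c) q -> d x y = d x q + d q y.
Proof.
  intros [[_ Hg] [Hac [<- <-]]] [r [Hr <-]]. unfold closed_itv in *.
  rewrite !Hg by lra. rewrite !Rabs_left1 by lra. ring.
Qed.

(* Thin triangle with vertices [g s], [g u] and a point from which [b] is nearly the distance. *)
Lemma basepoint_growth_three g I s t u : geodesic d I g -> I s -> I u -> s <= t <= u ->
  b (g t) + (u - t) - (2 * delta + 3) <= b (g u) \/
  b (g t) + (t - s) - (2 * delta + 3) <= b (g s).
Proof.
  intros Hg Is Iu Ht.
  (* The constant [2 * delta + 3] is the sum of [2 * (delta + 1)], from two uses of a point within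
     [delta + 1] of [g t], and of two approximation errors 1/2. *)
  destruct (@basepoint_approx (g s) (g t) (g u) (1 / 2)) as [p [c [H1 [H2 H3]]]]; [lra|].
  apply Rabs_def2 in H1. apply Rabs_def2 in H2. apply Rabs_def2 in H3.
  assert (Hg' : geodesic d (closed_itv s u) g) by (apply geodesic_sub with I; auto; lra).
  destruct (Hgeo (g u) p) as [g2 [a2 [c2 J2]]].
  destruct (Hgeo p (g s)) as [g3 [a3 [c3 J3]]].
  assert (J1 : geodesic_joining d g s u (g s) (g u)).
  { split; auto. repeat split; auto. lra. }
  assert (Tr : trace g (closed_itv s u) (g t)) by (exists t; unfold closed_itv; auto).
  pose proof (Hhyp J1 J2 J3 Tr) as H.
  apply dist_to_lt with (e := 1) in H; [|lra]. destruct H as [q [[Hq|Hq] Hlt]].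
  - left. pose proof (geodesic_dist_add J2 Hq) as E.
    destruct Hg' as [_ Hg']. unfold closed_itv in Hg'.
    pose proof (metric_tri Hd (g t) q p). pose proof (metric_tri Hd (g u) q (g t)).
    rewrite (Hg' u t), Rabs_right, (metric_sym Hd q (g t)) in * by lra. lra.
  - right. pose proof (geodesic_dist_add J3 Hq) as E.
    destruct Hg' as [_ Hg']. unfold closed_itv in Hg'.
    pose proof (metric_tri Hd (g t) q p). pose proof (metric_tri Hd (g t) q (g s)).
    rewrite (Hg' t s), Rabs_right, (metric_sym Hd p) in * by lra.
    rewrite (metric_sym Hd p q) in *. lra.
Qed.

(** The choice of direction is uniform: a [u] violating the first alternative and an [s] violating
    the second would together contradict [basepoint_growth_three]. *)
Lemma basepoint_growth g I t : geodesic d I g -> I t ->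
  (forall u, I u -> t <= u -> b (g t) + (u - t) - (2 * delta + 3) <= b (g u)) \/
  (forall s, I s -> s <= t -> b (g t) + (t - s) - (2 * delta + 3) <= b (g s)).
Proof.
  intros Hg It. apply NNPP. intros N. apply not_or_and in N. destruct N as [N1 N2].
  apply not_all_ex_not in N1. destruct N1 as [u Hu].
  apply not_all_ex_not in N2. destruct N2 as [s Hs].
  apply imply_to_and in Hu. destruct Hu as [Iu Hu]. apply imply_to_and in Hu.
  apply imply_to_and in Hs. destruct Hs as [Is Hs]. apply imply_to_and in Hs.
  destruct (@basepoint_growth_three g I s t u); auto; tauto.
Qed.

End Hyperbolic.

(** * Distances in the completion and limits of curves at their ends *)

Section Completion.

Variables (T : Type) (d : T -> T -> R).
Hypothesis Hd : is_metric d.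

Lemma cauchy_const x : cauchy_seq d (fun _ => x).
Proof. intros e He. exists 0%nat. intros. now rewrite metric_refl. Qed.

(** The distances [d (u n) (v n)] form a Cauchy sequence of reals, so [completion_dist] is a true
    limit and not a default value. *)
Lemma completion_dist_limit u v : cauchy_seq d u -> cauchy_seq d v ->
  is_lim_seq (fun n => d (u n) (v n)) (completion_dist d u v).
Proof.
  intros Hu Hv. assert (H : ex_finite_lim_seq (fun n => d (u n) (v n))).
  { apply ex_lim_seq_cauchy_corr. intros [e He]. simpl.
    destruct (Hu (e / 2)) as [N1 H1]; [lra|]. destruct (Hv (e / 2)) as [N2 H2]; [lra|].
    exists (max N1 N2). intros n m Hn Hm.
    specialize (H1 n m ltac:(lia) ltac:(lia)). specialize (H2 n m ltac:(lia) ltac:(lia)).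
    pose proof (metric_tri Hd (u n) (u m) (v n)). pose proof (metric_tri Hd (u m) (v m) (v n)).
    pose proof (metric_tri Hd (u m) (u n) (v m)). pose proof (metric_tri Hd (u n) (v n) (v m)).
    rewrite (metric_sym Hd (u m) (u n)), (metric_sym Hd (v m) (v n)) in *.
    apply Rabs_def1; lra. }
  destruct H as [l Hl]. unfold completion_dist. now rewrite (is_lim_seq_unique _ _ Hl).
Qed.

(** The real function [F] controls distances along [g], so convergence of [F] at the end forces
    convergence of [g] to a point of the completion. The representing sequence is sampled along [g],
    which later allows inequalities on the curve to pass to its ends. *)
Lemma end_limit_exists (I : R -> Prop) g e (F : R -> R) S :
  (forall s t, I s -> I t -> d (g s) (g t) <= Rabs (F s - F t)) ->
  filterlim F (within I (Rbar_locally e)) (locally S) ->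
  (forall eta, 0 < eta -> exists t, I t /\ Rabs (F t - S) < eta) ->
  exists tau : nat -> R, (forall n, I (tau n)) /\ is_lim_seq (fun n => F (tau n)) S /\
    end_limit d I g e (fun n => g (tau n)).
Proof.
  intros HF Hlim HS.
  destruct (functional_choice (fun n t => I t /\ Rabs (F t - S) < / (INR n + 1))) as [tau Htau].
  { intros n. apply HS. apply Rinv_0_lt_compat. pose proof (pos_INR n). lra. }
  assert (L : is_lim_seq (fun n => F (tau n)) S).
  { apply is_lim_seq_spec. intros [eta He]. simpl.
    destruct (archimed_cor1 eta He) as [N [HN1 HN2]].
    exists N. intros n Hn. destruct (Htau n) as [_ H].
    eapply Rlt_trans; [apply H|]. eapply Rle_lt_trans; [|apply HN1].
    apply Rinv_le_contravar; [now apply lt_0_INR|]. apply le_INR in Hn. lra. }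
  assert (C : cauchy_seq d (fun n => g (tau n))).
  { intros eta He. apply is_lim_seq_spec in L.
    destruct (L (mkposreal (eta / 2) ltac:(lra))) as [N HN]. simpl in HN.
    exists N. intros m n Hm Hn. eapply Rle_lt_trans; [apply HF; apply Htau|].
    specialize (HN m Hm) as H1. specialize (HN n Hn) as H2.
    apply Rabs_def2 in H1. apply Rabs_def2 in H2. apply Rabs_def1; lra. }
  exists tau. split; [intros n; apply Htau|]. split; auto. split; auto.
  (* The bound of [d (g t) (g (tau n))] by [Rabs (F t - F (tau n))] is passed to the limit in
     [n]. *)
  assert (Hbound : forall t, I t ->
    0 <= completion_dist d (fun _ => g t) (fun n => g (tau n)) <= Rabs (F t - S)).
  { intros t It. pose proof (completion_dist_limit (cauchy_const (g t)) C) as H. split.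
    - change (Rbar_le 0 (completion_dist d (fun _ => g t) (fun n => g (tau n)))).
      eapply is_lim_seq_le; [|apply is_lim_seq_const|exact H].
      intros n. now apply metric_pos.
    - change (Rbar_le (completion_dist d (fun _ => g t) (fun n => g (tau n))) (Rabs (F t - S))).
      apply is_lim_seq_le with (2 := H) (v := fun n => Rabs (F t - F (tau n))).
      + intros n. apply HF; auto. apply Htau.
      + apply (is_lim_seq_abs _ (F t - S)).
        apply is_lim_seq_minus'; auto. apply is_lim_seq_const. }
  apply filterlim_locally. intros eps.
  assert (HS' := proj1 (filterlim_locally F S) Hlim eps).
  unfold within in *. revert HS'. apply filter_imp. intros t H It.
  specialize (H It). specialize (Hbound t It).
  change (Rabs (F t - S) < eps) in H.
  change (Rabs (completion_dist d (fun _ => g t) (fun n => g (tau n)) - 0) < eps).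
  rewrite Rminus_0_r, Rabs_right; lra.
Qed.

End Completion.

(** * Monotone continuous functions at the ends of an interval *)

Section MonotoneEnds.

Variables (I : R -> Prop) (F : R -> R).
Hypothesis Hmono : forall s t, I s -> I t -> s <= t -> F s <= F t.
Hypothesis Hcont : forall t, I t -> forall e, 0 < e -> exists eta, 0 < eta /\
  forall s, I s -> Rabs (s - t) < eta -> Rabs (F s - F t) < e.

Lemma right_end_eventually t0 e : I t0 -> 0 < e ->
  within I (Rbar_locally (right_end I)) (fun t => F t0 - e < F t).
Proof.
  intros I0 He. unfold within, right_end.
  destruct (Lub_Rbar_correct I) as [H _]. specialize (H t0 I0).
  destruct (Lub_Rbar I) as [m| |]; try contradiction; simpl in *.
  - destruct (Rle_lt_or_eq_dec _ _ H) as [Hlt|<-].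
    + exists (mkposreal (m - t0) ltac:(lra)). intros t Ht It.
      change (Rabs (t - m) < m - t0) in Ht. apply Rabs_def2 in Ht.
      pose proof (Hmono I0 It). lra.
    + destruct (Hcont I0 He) as [eta [H1 H2]].
      exists (mkposreal eta H1). intros t Ht It. specialize (H2 t It Ht).
      apply Rabs_def2 in H2. lra.
  - exists t0. intros t Ht It. pose proof (Hmono I0 It). lra.
Qed.

Lemma left_end_eventually t0 e : I t0 -> 0 < e ->
  within I (Rbar_locally (left_end I)) (fun t => F t < F t0 + e).
Proof.
  intros I0 He. unfold within, left_end.
  destruct (Glb_Rbar_correct I) as [H _]. specialize (H t0 I0).
  destruct (Glb_Rbar I) as [m| |]; try contradiction; simpl in *.
  - destruct (Rle_lt_or_eq_dec _ _ H) as [Hlt|<-].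
    + exists (mkposreal (t0 - m) ltac:(lra)). intros t Ht It.
      change (Rabs (t - m) < t0 - m) in Ht. apply Rabs_def2 in Ht.
      pose proof (Hmono It I0). lra.
    + destruct (Hcont I0 He) as [eta [H1 H2]].
      exists (mkposreal eta H1). intros t Ht It. specialize (H2 t It Ht).
      apply Rabs_def2 in H2. lra.
  - exists t0. intros t Ht It. pose proof (Hmono It I0). lra.
Qed.

Lemma right_end_limit t1 B : I t1 -> (forall t, I t -> F t <= B) ->
  exists S, (forall t, I t -> F t <= S) /\
    filterlim F (within I (Rbar_locally (right_end I))) (locally S) /\
    (forall eta, 0 < eta -> exists t, I t /\ Rabs (F t - S) < eta).
Proof.
  intros I1 HB. destruct (completeness (fun r => exists t, I t /\ r = F t)) as [S [S1 S2]].
  - exists B. intros r [t [It ->]]. auto.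
  - exists (F t1), t1. auto.
  - assert (HS : forall t, I t -> F t <= S) by (intros t It; apply S1; exists t; auto).
    assert (HA : forall eta, 0 < eta -> exists t, I t /\ Rabs (F t - S) < eta).
    { intros eta He. apply NNPP. intros N.
      assert (S <= S - eta); [|lra]. apply S2. intros r [t [It ->]].
      apply Rnot_lt_le. intros Hlt. apply N. exists t. split; auto.
      specialize (HS t It). apply Rabs_def1; lra. }
    exists S. repeat split; auto. apply filterlim_locally. intros [eps He].
    destruct (HA (eps / 2)) as [t0 [I0 H0]]; [lra|]. apply Rabs_def2 in H0.
    pose proof (@right_end_eventually t0 (eps / 2) I0 ltac:(lra)) as H. unfold within in *.
    revert H. apply filter_imp. intros t H It. specialize (H It). specialize (HS t It).
    change (Rabs (F t - S) < eps). apply Rabs_def1; lra.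
Qed.

Lemma left_end_limit t1 B : I t1 -> (forall t, I t -> B <= F t) ->
  exists S, (forall t, I t -> S <= F t) /\
    filterlim F (within I (Rbar_locally (left_end I))) (locally S) /\
    (forall eta, 0 < eta -> exists t, I t /\ Rabs (F t - S) < eta).
Proof.
  (* The infimum of [F] is obtained as [- S], where [S] is the supremum of [- F]. *)
  intros I1 HB. destruct (completeness (fun r => exists t, I t /\ r = - F t)) as [S [S1 S2]].
  - exists (- B). intros r [t [It ->]]. specialize (HB t It). lra.
  - exists (- F t1), t1. auto.
  - assert (HS : forall t, I t -> - S <= F t).
    { intros t It. assert (- F t <= S); [|lra]. apply S1; exists t; auto. }
    assert (HA : forall eta, 0 < eta -> exists t, I t /\ Rabs (F t - - S) < eta).
    { intros eta He. apply NNPP. intros N.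
      assert (S <= S - eta); [|lra]. apply S2. intros r [t [It ->]].
      apply Rnot_lt_le. intros Hlt. apply N. exists t. split; auto.
      specialize (HS t It). apply Rabs_def1; lra. }
    exists (- S). repeat split; auto. apply filterlim_locally. intros [eps He].
    destruct (HA (eps / 2)) as [t0 [I0 H0]]; [lra|]. apply Rabs_def2 in H0.
    pose proof (@left_end_eventually t0 (eps / 2) I0 ltac:(lra)) as H. unfold within in *.
    revert H. apply filter_imp. intros t H It. specialize (H It). specialize (HS t It).
    change (Rabs (F t - - S) < eps). apply Rabs_def1; lra.
Qed.

End MonotoneEnds.

(** * The deformation by exp (- eps b) *)

Lemma exp_le x y : x <= y -> exp x <= exp y.
Proof.
  intros [H|<-]; [|lra]. apply Rlt_le. now apply exp_increasing.
Qed.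

Lemma is_RInt_exp_linear K c t p q : c <> 0 ->
  is_RInt (fun u => K * exp (- c * (u - t))) p q
    (K * (exp (- c * (p - t)) - exp (- c * (q - t))) / c).
Proof.
  intros Hc.
  replace (K * (exp (- c * (p - t)) - exp (- c * (q - t))) / c)
    with (minus (- K / c * exp (- c * (q - t))) (- K / c * exp (- c * (p - t)))).
  2:{ unfold minus, plus, opp; simpl. field. auto. }
  apply (is_RInt_derive (V := R_CompleteNormedModule) (fun u => - K / c * exp (- c * (u - t)))).
  - intros x _. auto_derive; auto. change (x + - t) with (x - t). field. auto.
  - intros x _. apply (ex_derive_continuous (V := R_NormedModule)). auto_derive. auto.
Qed.

Section Deformation.

Variables (T : Type) (d : T -> T -> R) (b : T -> R) (eps M : R).
Hypothesis Hd : is_metric d.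
Hypothesis Hgeo : geodesic_space d.
Hypothesis Hlip : forall x y, Rabs (b x - b y) <= d x y.
Hypothesis Heps : 0 < eps.
Hypothesis HM : 1 <= M.
Hypothesis HGH : GH_density d M (rho_eps eps b).

Let rho := rho_eps eps b.
Let D := d_eps d eps b.
Let Hrho : density d rho := proj1 HGH.

Lemma rho_eps_pos x : 0 < rho x.
Proof. apply exp_pos. Qed.

(** Harnack inequality: [b] is 1-Lipschitz, so [rho] changes at most by the factor
    [exp (eps * d x y)]. *)
Lemma rho_eps_harnack x y : rho x * exp (- eps * d x y) <= rho y.
Proof.
  unfold rho, rho_eps. rewrite <- exp_plus. apply exp_le.
  pose proof (Rle_trans _ _ _ (Rle_abs _) (Hlip y x)). rewrite (metric_sym Hd) in H.
  assert (eps * (b y - b x) <= eps * d x y) by (apply Rmult_le_compat_l; lra). lra.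
Qed.

Lemma rho_eps_harnack_upper x y : rho y <= rho x * exp (eps * d x y).
Proof.
  unfold rho, rho_eps. rewrite <- exp_plus. apply exp_le.
  pose proof (Rle_trans _ _ _ (Rle_abs _) (Hlip x y)).
  assert (eps * (b x - b y) <= eps * d x y) by (apply Rmult_le_compat_l; lra). lra.
Qed.

Lemma GH_geodesic_length g p q : p <= q -> geodesic d (closed_itv p q) g ->
  RInt (fun t => rho (g t)) p q <= M * D (g p) (g q).
Proof.
  intros Hpq Hg. pose proof (proj2 HGH (g p) (g q) g p q) as H.
  change (rho_eps eps b) with rho in H. rewrite (rho_length_geodesic Hd Hrho Hpq Hg) in H.
  apply H. split; [exact Hg|]. repeat split; auto.
Qed.

Lemma d_eps_le_geodesic_length g p q : p <= q -> geodesic d (closed_itv p q) g ->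
  D (g p) (g q) <= RInt (fun t => rho (g t)) p q.
Proof. intros. apply d_rho_le_geodesic; auto. Qed.

Lemma RInt_rho_geodesic_upper g p q t : p <= q -> geodesic d (closed_itv p q) g ->
  p <= t <= q ->
  RInt (fun u => rho (g u)) p q <= rho (g t) * exp (eps * (q - p)) * (q - p).
Proof.
  intros Hpq Hg Ht.
  replace (rho (g t) * exp (eps * (q - p)) * (q - p))
    with (RInt (fun _ => rho (g t) * exp (eps * (q - p))) p q).
  2:{ rewrite RInt_const. unfold scal; simpl; unfold mult; simpl. ring. }
  apply RInt_le; auto.
  - now apply (ex_RInt_geodesic Hrho).
  - apply ex_RInt_const.
  - intros u Hu. eapply Rle_trans; [apply (rho_eps_harnack_upper (g t))|].
    apply Rmult_le_compat_l; [apply Rlt_le, rho_eps_pos|].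
    apply exp_le. apply Rmult_le_compat_l; [lra|].
    destruct Hg as [_ Hg]. unfold closed_itv in Hg. rewrite Hg by lra.
    apply Rabs_le. lra.
Qed.

Lemma d_eps_upper x y : D x y <= rho x * exp (eps * d x y) * d x y.
Proof.
  destruct (Hgeo x y) as [g [p [q [Hg [Hpq [<- <-]]]]]].
  eapply Rle_trans; [now apply d_eps_le_geodesic_length|].
  assert (d (g p) (g q) = q - p) as ->.
  { destruct Hg as [_ Hg]. unfold closed_itv in Hg. rewrite Hg, Rabs_left1; lra. }
  apply RInt_rho_geodesic_upper; auto. lra.
Qed.

(** The GH-inequality bounds [M * D x y] below by the integral of [rho] over the initial piece, of
    length [Rmin 1 (d x y)], of a geodesic; there [rho] is at least [exp (- eps) * rho x]. *)
Lemma d_eps_lower x y : exp (- eps) / M * rho x * Rmin 1 (d x y) <= D x y.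
Proof.
  destruct (Hgeo x y) as [g [p [q [Hg [Hpq [<- <-]]]]]].
  assert (Hdist : forall t, p <= t <= q -> d (g p) (g t) = t - p).
  { intros t Ht. destruct Hg as [_ Hg]. unfold closed_itv in Hg. rewrite Hg, Rabs_left1; lra. }
  rewrite Hdist by lra. set (m := Rmin 1 (q - p)).
  assert (0 <= m) by (apply Rmin_glb; lra).
  assert (m <= 1) by apply Rmin_l. assert (m <= q - p) by apply Rmin_r.
  pose proof (GH_geodesic_length Hpq Hg) as H2.
  pose proof (ex_RInt_geodesic Hrho Hpq Hg) as Hex.
  assert (X1 : ex_RInt (fun t => rho (g t)) p (p + m)).
  { apply (ex_RInt_Chasles_1 (V := R_CompleteNormedModule)) with q; auto. lra. }
  assert (X2 : ex_RInt (fun t => rho (g t)) (p + m) q).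
  { apply (ex_RInt_Chasles_2 (V := R_CompleteNormedModule)) with p; auto. lra. }
  assert (E := RInt_Chasles (V := R_CompleteNormedModule) _ _ _ _ X1 X2).
  unfold plus in E; simpl in E.
  assert (0 <= RInt (fun t => rho (g t)) (p + m) q).
  { apply RInt_ge_0; auto; [lra|]. intros; apply Rlt_le, rho_eps_pos. }
  assert (rho (g p) * exp (- eps) * m <= RInt (fun t => rho (g t)) p (p + m)).
  { replace (rho (g p) * exp (- eps) * m)
      with (RInt (fun _ => rho (g p) * exp (- eps)) p (p + m)).
    2:{ rewrite RInt_const. unfold scal; simpl; unfold mult; simpl. ring. }
    apply RInt_le; auto; [lra|apply ex_RInt_const|].
    intros u Hu. eapply Rle_trans; [|apply (rho_eps_harnack (g p))].
    apply Rmult_le_compat_l; [apply Rlt_le, rho_eps_pos|].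
    apply exp_le. rewrite Hdist by lra.
    assert (eps * (u - p) <= eps * 1) by (apply Rmult_le_compat_l; lra). lra. }
  apply Rmult_le_reg_l with M; [lra|].
  replace (M * (exp (- eps) / M * rho (g p) * m)) with (rho (g p) * exp (- eps) * m) by (field; lra).
  lra.
Qed.

Lemma d_eps_metric : is_metric D.
Proof.
  repeat split.
  - intros x y. apply Rle_ge. now apply d_rho_nonneg.
  - intros x y. now apply d_rho_sym.
  - intros H. apply (metric_eq0 Hd). apply Rnot_lt_le. intros Hpos.
    pose proof (d_eps_lower x y) as L. rewrite H in L.
    assert (0 < Rmin 1 (d x y)) by (apply Rmin_pos; lra).
    assert (0 < exp (- eps) / M * rho x * Rmin 1 (d x y)); [|lra].
    repeat apply Rmult_lt_0_compat; auto; [apply exp_pos|apply Rinv_0_lt_compat; lra|apply rho_eps_pos].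
  - intros <-. apply Rle_antisym.
    + pose proof (d_eps_upper x x) as H. rewrite (metric_refl Hd x), Rmult_0_r in H. exact H.
    + now apply d_rho_nonneg.
  - intros x y z. now apply d_rho_tri.
Qed.

(** Inversion of [d_eps_lower]: a minimum of 1 and [d x y] that is below [e <= 1] must be
    [d x y]. *)
Lemma d_eps_small x y e : 0 < e <= 1 -> D x y < exp (- eps) / M * rho x * e -> d x y < e.
Proof.
  intros He H. pose proof (d_eps_lower x y) as L.
  assert (P : 0 < exp (- eps) / M * rho x).
  { repeat apply Rmult_lt_0_compat; [apply exp_pos|apply Rinv_0_lt_compat; lra|apply rho_eps_pos]. }
  assert (Rmin 1 (d x y) < e) by (apply Rmult_lt_reg_l with (1 := P); lra).
  unfold Rmin in *. destruct (Rle_dec 1 (d x y)); lra.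
Qed.

Lemma seq_limit_d_eps u x : seq_limit d u x -> seq_limit D u x.
Proof.
  intros H. apply is_lim_seq_spec in H. apply is_lim_seq_spec. intros [e He]. simpl.
  (* On the unit ball about [x], [d_eps_upper] bounds [D x y] by [c * d x y]. *)
  pose (c := rho x * exp eps).
  assert (0 < c) by (apply Rmult_lt_0_compat; [apply rho_eps_pos|apply exp_pos]).
  assert (Hm : 0 < Rmin 1 (e / c)).
  { apply Rmin_pos; [lra|]. now apply Rdiv_lt_0_compat. }
  destruct (H (mkposreal _ Hm)) as [N HN]. simpl in HN. exists N. intros n Hn.
  specialize (HN n Hn). rewrite Rminus_0_r, Rabs_right in * by (apply Rle_ge, metric_pos; auto; apply d_eps_metric).
  pose proof (Rmin_l 1 (e / c)). pose proof (Rmin_r 1 (e / c)).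
  rewrite (metric_sym d_eps_metric). rewrite (metric_sym Hd) in HN.
  eapply Rle_lt_trans; [apply d_eps_upper|]. pose proof (metric_pos Hd x (u n)).
  apply Rle_lt_trans with (c * d x (u n)).
  - apply Rmult_le_compat_r; auto. apply Rmult_le_compat_l; [apply Rlt_le, rho_eps_pos|].
    apply exp_le. rewrite <- (Rmult_1_r eps) at 2. apply Rmult_le_compat_l; lra.
  - replace e with (c * (e / c)) by (field; lra). apply Rmult_lt_compat_l; lra.
Qed.

(** A boundary sequence closer to [x] than this would eventually stay in the unit [d]-ball about
    [x]. There [rho] is bounded below, so the sequence is [d]-Cauchy; its [d]-limit would also be a
    [D]-limit. *)
Lemma boundary_dist_lower x : metric_complete d ->
  Rbar_le (exp (- eps) / M * rho x) (boundary_dist D x).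
Proof.
  intros Hcomp. apply Glb_Rbar_correct. intros r [u [[Cu Nu] ->]]. simpl.
  set (c := exp (- eps) / M).
  assert (Hc : 0 < c) by (apply Rmult_lt_0_compat; [apply exp_pos|apply Rinv_0_lt_compat; lra]).
  apply Rnot_lt_le. intros Hlt.
  pose proof (completion_dist_limit d_eps_metric (cauchy_const d_eps_metric x) Cu) as L.
  set (l := completion_dist D (fun _ => x) u) in *.
  apply is_lim_seq_spec in L.
  destruct (L (mkposreal (c * rho x - l) ltac:(lra))) as [N1 H1]. simpl in H1.
  assert (Hnear : forall n, (N1 <= n)%nat -> d x (u n) < 1).
  { intros n Hn. apply d_eps_small; [lra|]. fold c. specialize (H1 n Hn).
    apply Rabs_def2 in H1. lra. }
  assert (C : cauchy_seq d u).
  { intros e He. pose (e' := Rmin 1 e).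
    assert (He' : 0 < e') by (apply Rmin_pos; lra).
    pose proof (Rmin_l 1 e). pose proof (Rmin_r 1 e). fold e' in H, H0.
    (* Since [d x (u m) < 1], this threshold is at most [c * rho (u m) * e'], as [d_eps_small] at
       [u m] demands. *)
    destruct (Cu (c * (rho x * exp (- eps)) * e')) as [N2 H2].
    { apply Rmult_lt_0_compat; auto. apply Rmult_lt_0_compat; auto.
      apply Rmult_lt_0_compat; [apply rho_eps_pos|apply exp_pos]. }
    exists (max N1 N2). intros m n Hm Hn.
    apply Rlt_le_trans with e'; auto. apply d_eps_small; [lra|]. fold c.
    eapply Rlt_le_trans; [apply H2; lia|].
    apply Rmult_le_compat_r; [lra|]. apply Rmult_le_compat_l; [lra|].
    eapply Rle_trans; [|apply (rho_eps_harnack x)].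
    apply Rmult_le_compat_l; [apply Rlt_le, rho_eps_pos|]. apply exp_le.
    specialize (Hnear m ltac:(lia)).
    assert (eps * d x (u m) <= eps * 1) by (apply Rmult_le_compat_l; lra). lra. }
  destruct (Hcomp u C) as [y Hy]. apply (Nu y). now apply seq_limit_d_eps.
Qed.

(** * Geodesics as curves of the deformed space *)

Section Geodesic.

Variables (I : R -> Prop) (g : R -> T) (t1 : R).
Hypothesis Hg : geodesic d I g.
Hypothesis I1 : I t1.

(** Signed rho-length from [t1]. Distances [D] along [g] are at most the increments of [F] and at
    least these divided by [M], so lengths and ends are read off this monotone function. *)
Let F t := RInt (fun u => rho (g u)) t1 t.

Lemma RInt_rho_geodesic_diff s t : I s -> I t -> s <= t ->
  F t - F s = RInt (fun u => rho (g u)) s t.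
Proof.
  intros Is It Hst.
  assert (X : forall s t, I s -> I t -> ex_RInt (fun u => rho (g u)) s t).
  { clear s t Is It Hst. intros s t Is It. destruct (Rle_dec s t).
    - apply (ex_RInt_geodesic Hrho); auto. now apply geodesic_sub with I.
    - apply ex_RInt_swap. apply (ex_RInt_geodesic Hrho); [lra|].
      apply geodesic_sub with I; auto; lra. }
  assert (E := RInt_Chasles (V := R_CompleteNormedModule) _ _ _ _ (X t1 s I1 Is) (X s t Is It)).
  unfold plus in E; simpl in E. unfold F. lra.
Qed.

Lemma RInt_rho_geodesic_mono s t : I s -> I t -> s <= t -> F s <= F t.
Proof.
  intros Is It Hst. cut (0 <= F t - F s); [lra|]. rewrite RInt_rho_geodesic_diff; auto.
  apply RInt_ge_0; auto.
  - apply (ex_RInt_geodesic Hrho); auto. now apply geodesic_sub with I.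
  - intros u _. apply Rlt_le, rho_eps_pos.
Qed.

Lemma RInt_rho_geodesic_cont t : I t -> forall e, 0 < e -> exists eta, 0 < eta /\
  forall s, I s -> Rabs (s - t) < eta -> Rabs (F s - F t) < e.
Proof.
  intros It e He. pose (c := rho (g t) * exp eps).
  assert (0 < c) by (apply Rmult_lt_0_compat; [apply rho_eps_pos|apply exp_pos]).
  exists (Rmin 1 (e / c)). split.
  { apply Rmin_pos; [lra|]. now apply Rdiv_lt_0_compat. }
  intros s Is Hs. pose proof (Rmin_l 1 (e / c)). pose proof (Rmin_r 1 (e / c)).
  assert (B : forall p q, I p -> I q -> p <= t <= q -> q - p < Rmin 1 (e / c) -> F q - F p < e).
  { intros p q Ip Iq Hpq Hlt. rewrite RInt_rho_geodesic_diff by (auto; lra).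
    eapply Rle_lt_trans.
    - apply (RInt_rho_geodesic_upper (t := t)); [lra| |lra]. apply geodesic_sub with I; auto; lra.
    - apply Rle_lt_trans with (c * (q - p)).
      + apply Rmult_le_compat_r; [lra|]. apply Rmult_le_compat_l; [apply Rlt_le, rho_eps_pos|].
        apply exp_le. rewrite <- (Rmult_1_r eps) at 2. apply Rmult_le_compat_l; lra.
      + replace e with (c * (e / c)) by (field; lra). apply Rmult_lt_compat_l; lra. }
  apply Rabs_def2 in Hs. destruct (Rle_dec s t).
  - specialize (B s t Is It ltac:(lra) ltac:(lra)). pose proof (RInt_rho_geodesic_mono Is It r).
    apply Rabs_def1; lra.
  - specialize (B t s It Is ltac:(lra) ltac:(lra)).
    pose proof (@RInt_rho_geodesic_mono t s It Is ltac:(lra)).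
    apply Rabs_def1; lra.
Qed.

Lemma d_eps_le_RInt s t : I s -> I t -> D (g s) (g t) <= Rabs (F s - F t).
Proof.
  intros Is It. destruct (Rle_dec s t) as [H|H].
  - rewrite Rabs_minus_sym. eapply Rle_trans; [|apply Rle_abs].
    rewrite RInt_rho_geodesic_diff by auto. apply d_eps_le_geodesic_length; auto.
    now apply geodesic_sub with I.
  - rewrite (metric_sym d_eps_metric). eapply Rle_trans; [|apply Rle_abs].
    rewrite RInt_rho_geodesic_diff by (auto; lra). apply d_eps_le_geodesic_length; [lra|].
    apply geodesic_sub with I; auto; lra.
Qed.

Lemma RInt_le_d_eps s t : I s -> I t -> F t - F s <= M * D (g s) (g t).
Proof.
  intros Is It. destruct (Rle_dec s t) as [H|H].
  - rewrite RInt_rho_geodesic_diff by auto. apply GH_geodesic_length; auto.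
    now apply geodesic_sub with I.
  - pose proof (@RInt_rho_geodesic_mono t s It Is ltac:(lra)).
    assert (0 <= M * D (g s) (g t)); [|lra].
    apply Rmult_le_pos; [lra|]. apply metric_pos, d_eps_metric.
Qed.

Lemma chain_le_RInt (J : R -> Prop) p q r : (forall t, J t -> I t) ->
  chain D g J p q r -> r <= F q - F p.
Proof.
  intros HJ. induction 1 as [_|q q' r H IH Hq Jq']; [lra|].
  destruct (chain_bounds d_eps_metric H) as [_ [Jq _]].
  pose proof (d_eps_le_RInt (HJ _ Jq) (HJ _ Jq')) as H1.
  pose proof (RInt_rho_geodesic_mono (HJ _ Jq) (HJ _ Jq') Hq).
  rewrite Rabs_left1 in H1 by lra. lra.
Qed.

Lemma is_curve_d_eps : is_curve D I g.
Proof.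
  split; [apply Hg|]. intros t It e He.
  destruct (RInt_rho_geodesic_cont It He) as [eta [H1 H2]]. exists eta. split; auto.
  intros s Is Hs. eapply Rle_lt_trans; [apply d_eps_le_RInt; auto|]. auto.
Qed.

(** By the GH-inequality [F] oscillates by at most [M * L], hence has limits [S0] and [S1] at the
    ends. The length is at most [S1 - S0], and the GH-inequality between sampled points passes to
    the limit. *)
Lemma finite_length_ends : is_finite (curve_length D g I) ->
  exists u v, end_limit D I g (left_end I) u /\ end_limit D I g (right_end I) v /\
    Rbar_le (curve_length D g I) (M * completion_dist D u v).
Proof.
  intros Hfin. pose (L := real (curve_length D g I)).
  assert (HL : curve_length D g I = Finite L) by (symmetry; exact Hfin).
  assert (Hbd : forall s t, I s -> I t -> s <= t -> F t - F s <= M * L).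
  { intros s t Is It Hst. eapply Rle_trans; [now apply RInt_le_d_eps|].
    apply Rmult_le_compat_l; [lra|].
    assert (C : chain D g I s t (0 + D (g s) (g t))) by (apply chain_step; auto; now apply chain_point).
    apply (chain_le_curve_length d_eps_metric) in C. rewrite HL in C. simpl in C. lra. }
  assert (HL0 : 0 <= M * L) by (specialize (Hbd t1 t1 I1 I1); lra).
  destruct (@right_end_limit I F RInt_rho_geodesic_mono RInt_rho_geodesic_cont t1 (F t1 + M * L))
    as [S1 [A1 [B1 C1]]]; auto.
  { intros t It. destruct (Rle_dec t1 t) as [H|H].
    - specialize (Hbd t1 t I1 It H). lra.
    - pose proof (@RInt_rho_geodesic_mono t t1 It I1 ltac:(lra)). lra. }
  destruct (@left_end_limit I F RInt_rho_geodesic_mono RInt_rho_geodesic_cont t1 (F t1 - M * L))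
    as [S0 [A0 [B0 C0]]]; auto.
  { intros t It. destruct (Rle_dec t t1) as [H|H].
    - specialize (Hbd t t1 It I1 H). lra.
    - pose proof (@RInt_rho_geodesic_mono t1 t I1 It ltac:(lra)). lra. }
  destruct (end_limit_exists d_eps_metric d_eps_le_RInt B0 C0) as [tau0 [T0 [L0 E0]]].
  destruct (end_limit_exists d_eps_metric d_eps_le_RInt B1 C1) as [tau1 [T1 [L1 E1]]].
  exists (fun n => g (tau0 n)), (fun n => g (tau1 n)). split; auto. split; auto.
  apply Rbar_le_trans with (S1 - S0).
  - apply curve_length_le. intros p q r C.
    destruct (chain_bounds d_eps_metric C) as [Ip [Iq _]].
    apply chain_le_RInt in C; auto. specialize (A1 q Iq). specialize (A0 p Ip). simpl. lra.
  - pose proof (completion_dist_limit d_eps_metric (proj1 E0) (proj1 E1)) as Lc.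
    eapply is_lim_seq_le; [|apply is_lim_seq_minus'; [exact L1|exact L0]|
                            apply (is_lim_seq_scal_l _ M _ Lc)].
    intros n. now apply RInt_le_d_eps.
Qed.

Lemma infinite_length_ends : curve_length D g I = p_infty ->
  filterlim (fun p : R * R => D (g (fst p)) (g (snd p)))
    (filter_prod (within I (Rbar_locally (left_end I))) (within I (Rbar_locally (right_end I))))
    (Rbar_locally p_infty).
Proof.
  intros HL P [B HB].
  (* The 2 pays for the unit lost at each end, leaving [F t - F s > M * B] for [s] and [t] near the
     ends. *)
  destruct (lt_curve_length (d := D) (g := g) (I := I) (C := M * B + 2)) as [p [q [r [C Hr]]]].
  { rewrite HL. exact Logic.I. }
  destruct (chain_bounds d_eps_metric C) as [Ip [Iq _]].
  apply chain_le_RInt in C; auto.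
  pose proof (left_end_eventually RInt_rho_geodesic_mono RInt_rho_geodesic_cont Ip Rlt_0_1) as H0.
  pose proof (right_end_eventually RInt_rho_geodesic_mono RInt_rho_geodesic_cont Iq Rlt_0_1) as H1.
  apply Filter_prod with (fun s => I s /\ F s < F p + 1) (fun t => I t /\ F q - 1 < F t).
  - unfold within in *. revert H0. apply filter_imp. auto.
  - unfold within in *. revert H1. apply filter_imp. auto.
  - intros s t [Is Hs] [It Ht]. simpl. apply HB. apply Rmult_lt_reg_l with M; [lra|].
    pose proof (RInt_le_d_eps Is It). lra.
Qed.

(** [c = eps] serves the part of [g] after [t] and [c = - eps] the part before it; the sign
    conditions place [p] and [q] on that side. There [rho] is at most [rho (g t) * exp (eps * C)]
    times an exponential decaying at rate [eps] away from [t], whose integral is at most [/ eps]. *)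
Lemma RInt_rho_geodesic_growth c C t p q : I p -> I q -> p <= q ->
  c = eps \/ c = - eps -> 0 <= c * (p - t) -> 0 <= c * (q - t) ->
  (forall u, I u -> p <= u <= q -> b (g t) + c / eps * (u - t) - C <= b (g u)) ->
  F q - F p <= rho (g t) * exp (eps * C) / eps.
Proof.
  intros Ip Iq Hpq Hc Hcp Hcq Hgrow. rewrite RInt_rho_geodesic_diff by auto.
  set (K := rho (g t) * exp (eps * C)).
  assert (HK : 0 < K) by (apply Rmult_lt_0_compat; [apply rho_eps_pos|apply exp_pos]).
  assert (Hc0 : c <> 0) by (destruct Hc; lra).
  pose proof (@is_RInt_exp_linear K c t p q Hc0) as HI.
  apply Rle_trans with (RInt (fun u => K * exp (- c * (u - t))) p q).
  - apply RInt_le; auto.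
    + apply (ex_RInt_geodesic Hrho); auto. now apply geodesic_sub with I.
    + eexists. exact HI.
    + intros u Hu. unfold K, rho, rho_eps. rewrite <- !exp_plus. apply exp_le.
      assert (Iu : I u) by (destruct Hg as [[_ HI'] _]; apply HI' with p q; auto; lra).
      specialize (Hgrow u Iu ltac:(lra)). apply (Rmult_le_compat_l eps) in Hgrow; [|lra].
      replace (eps * (b (g t) + c / eps * (u - t) - C))
        with (eps * b (g t) + c * (u - t) - eps * C) in Hgrow by (field; lra). lra.
  - assert (E : RInt (fun u => K * exp (- c * (u - t))) p q =
       K * (exp (- c * (p - t)) - exp (- c * (q - t))) / c) by now apply is_RInt_unique.
    rewrite E.
    assert (B : forall x, 0 <= c * x -> 0 < exp (- c * x) <= 1).
    { intros x Hx. split; [apply exp_pos|]. rewrite <- exp_0. apply exp_le. lra. }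
    pose proof (B (p - t) Hcp) as Bp. pose proof (B (q - t) Hcq) as Bq.
    assert (He : 0 < / eps) by (apply Rinv_0_lt_compat; lra).
    destruct Hc as [->| ->].
    + apply Rmult_le_compat_r; [lra|]. rewrite <- (Rmult_1_r K) at 2.
      apply Rmult_le_compat_l; lra.
    + replace (K * (exp (- - eps * (p - t)) - exp (- - eps * (q - t))) / - eps)
        with (K * (exp (- - eps * (q - t)) - exp (- - eps * (p - t))) / eps) by (field; lra).
      apply Rmult_le_compat_r; [lra|]. rewrite <- (Rmult_1_r K) at 2.
      apply Rmult_le_compat_l; lra.
Qed.

Lemma min_half_length_le C t : I t ->
  (forall u, I u -> t <= u -> b (g t) + (u - t) - C <= b (g u)) \/
  (forall s, I s -> s <= t -> b (g t) + (t - s) - C <= b (g s)) ->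
  Rbar_le (Rbar_min (curve_length D g (fun s => I s /\ s <= t))
                    (curve_length D g (fun s => I s /\ t <= s)))
          (rho (g t) * exp (eps * C) / eps).
Proof.
  intros It [Hgrow|Hgrow].
  - eapply Rbar_le_trans; [apply Rbar_min_r|]. apply curve_length_le. intros p q r Ch. simpl.
    destruct (chain_bounds d_eps_metric Ch) as [[Ip Hp] [[Iq Hq] [Hpq _]]].
    eapply Rle_trans; [apply (chain_le_RInt (J := fun s => I s /\ t <= s)) with (2 := Ch); tauto|].
    apply RInt_rho_geodesic_growth with eps; auto; try (apply Rmult_le_pos; lra).
    intros u Iu Hu. replace (eps / eps * (u - t)) with (u - t) by (field; lra).
    apply Hgrow; auto; lra.
  - eapply Rbar_le_trans; [apply Rbar_min_l|]. apply curve_length_le. intros p q r Ch. simpl.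
    destruct (chain_bounds d_eps_metric Ch) as [[Ip Hp] [[Iq Hq] [Hpq _]]].
    eapply Rle_trans; [apply (chain_le_RInt (J := fun s => I s /\ s <= t)) with (2 := Ch); tauto|].
    assert (Hneg : forall x, x <= 0 -> 0 <= - eps * x).
    { intros x Hx. replace (- eps * x) with (eps * - x) by ring. apply Rmult_le_pos; lra. }
    apply RInt_rho_geodesic_growth with (- eps); auto; try (apply Hneg; lra).
    intros u Iu Hu. replace (- eps / eps * (u - t)) with (t - u) by (field; lra).
    apply Hgrow; auto; lra.
Qed.

Lemma geodesic_uniform_curve C A : metric_complete d ->
  (forall t, I t ->
     (forall u, I u -> t <= u -> b (g t) + (u - t) - C <= b (g u)) \/
     (forall s, I s -> s <= t -> b (g t) + (t - s) - C <= b (g s))) ->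
  M <= A -> M * exp (eps * (C + 1)) / eps <= A ->
  uniform_curve D A I g.
Proof.
  intros Hcomp Hgrow HMA HA. split; [exact is_curve_d_eps|]. split; [|split].
  - intros HL. destruct (finite_length_ends HL) as [u [v [E0 [E1 Hle]]]].
    exists u, v. split; auto. split; auto. eapply Rbar_le_trans; [exact Hle|].
    simpl. apply Rmult_le_compat_r; auto.
    pose proof (completion_dist_limit d_eps_metric (proj1 E0) (proj1 E1)) as Lc.
    change (Rbar_le 0 (completion_dist D u v)).
    eapply is_lim_seq_le; [|apply is_lim_seq_const|exact Lc].
    intros n. apply metric_pos, d_eps_metric.
  - exact infinite_length_ends.
  - intros t It. eapply Rbar_le_trans; [exact (min_half_length_le It (Hgrow t It))|].
    pose proof (boundary_dist_lower (g t) Hcomp) as HB.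
    destruct (boundary_dist D (g t)) as [m| |]; simpl in HB; try contradiction.
    + simpl. eapply Rle_trans; [|apply Rmult_le_compat_l; [lra|exact HB]].
      pose proof (rho_eps_pos (g t)) as Hr. pose proof (exp_pos (- eps)) as He.
      eapply Rle_trans; [|apply Rmult_le_compat_r; [|exact HA]].
      2:{ apply Rlt_le. repeat apply Rmult_lt_0_compat; auto. apply Rinv_0_lt_compat. lra. }
      (* The extra 1 in [C + 1] compensates the factor [exp (- eps)] in the bound for the boundary
         distance. *)
      apply Req_le. replace (eps * (C + 1)) with (eps * C + eps) by ring.
      rewrite exp_plus, exp_Ropp. field. pose proof (exp_pos eps). lra.
    (* The boundary distance is infinite here; since [A > 0], its product with [A] is [+oo] and not
       the conventional value 0. *)
    + assert (A0 : 0 < A) by lra. unfold Rbar_mult, Rbar_mult'.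
      destruct (Rle_dec 0 A); [|lra]. destruct (Rle_lt_or_eq_dec 0 A r); [exact Logic.I|lra].
Qed.

End Geodesic.

(** * Incompleteness and boundedness of the deformed space *)

Lemma ray_not_complete g C : geodesic_ray d g ->
  (forall u, 0 <= u -> b (g 0) + u - C <= b (g u)) -> ~ metric_complete D.
Proof.
  intros Hg Hgrow Hcomp.
  assert (I0 : half_line 0) by (unfold half_line; lra).
  assert (In : forall n, half_line (INR n)) by (intros n; apply pos_INR).
  pose (F := fun t => RInt (fun u => rho (g u)) 0 t).
  (* Growth of [b] makes [rho] integrable along the ray, so [F] is increasing and bounded at the
     integers, and its increments dominate [D]. *)
  assert (Cu : cauchy_seq D (fun n => g (INR n))).
  { assert (ex_finite_lim_seq (fun n => F (INR n))) as L.
    { apply ex_finite_lim_seq_incr with (F 0 + rho (g 0) * exp (eps * C) / eps).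
      - intros n. apply (RInt_rho_geodesic_mono Hg I0); auto. apply le_INR. lia.
      - intros n. cut (F (INR n) - F 0 <= rho (g 0) * exp (eps * C) / eps); [lra|].
        pose proof (pos_INR n).
        apply (RInt_rho_geodesic_growth Hg I0 (c := eps)); auto.
        + lra.
        + apply Rmult_le_pos; lra.
        + intros u _ Hu. replace (eps / eps * (u - 0)) with u by (field; lra).
          apply Hgrow; lra. }
    apply ex_lim_seq_cauchy_corr in L. intros e He.
    destruct (L (mkposreal e He)) as [N HN]. exists N. intros m n Hm Hn.
    eapply Rle_lt_trans; [apply (d_eps_le_RInt Hg I0); auto|]. now apply HN. }
  (* By [d_eps_small] a [D]-limit [x] would have all late points of the sequence within [d]-distance
     1, whereas [d (g (INR n)) (g 0)] is unbounded. *)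
  destruct (Hcomp _ Cu) as [x Hx]. apply is_lim_seq_spec in Hx.
  assert (P : 0 < exp (- eps) / M * rho x * 1).
  { repeat apply Rmult_lt_0_compat; [apply exp_pos|apply Rinv_0_lt_compat; lra|apply rho_eps_pos|lra]. }
  destruct (Hx (mkposreal _ P)) as [N HN]. simpl in HN.
  destruct (INR_unbounded (d x (g 0) + 1)) as [k Hk].
  pose (n := max N k). assert (INR k <= INR n) by (apply le_INR; lia).
  specialize (HN n ltac:(lia)). rewrite Rminus_0_r in HN.
  apply Rle_lt_trans with (1 := Rle_abs _) in HN. rewrite (metric_sym d_eps_metric) in HN.
  apply d_eps_small in HN; [|lra].
  pose proof (metric_tri Hd (g (INR n)) x (g 0)) as Ht.
  rewrite (proj2 Hg (INR n) 0), Rabs_right, (metric_sym Hd (g (INR n)) x) in Ht; auto; [lra|].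
  pose proof (pos_INR n). lra.
Qed.

(** Along a geodesic from [z] the function [b] grows exactly at unit speed, so the growth estimate
    with [C = 0] bounds the distance [D] to [z] by [rho z / eps]. *)
Lemma d_eps_bounded z s : (forall x, b x = d x z + s) -> metric_bounded D.
Proof.
  intros Hb.
  assert (HB : forall x, D x z <= exp (- eps * s) / eps).
  { intros x. rewrite (metric_sym d_eps_metric).
    destruct (Hgeo z x) as [g [p [q [Hg [Hpq [<- <-]]]]]].
    eapply Rle_trans; [apply d_eps_le_geodesic_length; auto|].
    assert (Ip : closed_itv p q p) by (unfold closed_itv; lra).
    assert (Iq : closed_itv p q q) by (unfold closed_itv; lra).
    pose proof (RInt_rho_geodesic_diff Hg Ip Ip Iq Hpq) as E. rewrite <- E.
    eapply Rle_trans; [apply (RInt_rho_geodesic_growth Hg Ip (c := eps) (C := 0) (t := p)); auto|].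
    - rewrite Rminus_diag. lra.
    - apply Rmult_le_pos; lra.
    - intros u Iu Hu. rewrite !Hb, (metric_sym Hd (g u)), (metric_refl Hd).
      destruct Hg as [_ Hg]. rewrite Hg, Rabs_left1 by (auto; lra).
      apply Req_le. field. lra.
    - unfold rho, rho_eps. rewrite Hb, (metric_refl Hd), Rmult_0_r, exp_0.
      rewrite Rmult_1_r, Rplus_0_l. lra. }
  exists (2 * (exp (- eps * s) / eps)). intros x y.
  pose proof (metric_tri d_eps_metric x z y). rewrite (metric_sym d_eps_metric z y) in H.
  pose proof (HB x). pose proof (HB y). lra.
Qed.

(** On the ray [rho] is at least [exp (- eps * s)], so rho-length grows at least linearly, and by
    the GH-inequality so does [D (g 0) (g t)]. *)
Lemma d_eps_unbounded g s : geodesic_ray d g -> (forall t, 0 <= t -> b (g t) <= s - t) ->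
  ~ metric_bounded D.
Proof.
  intros Hg Hdec [B HB].
  pose proof (metric_pos d_eps_metric (g 0) (g 0)). pose proof (HB (g 0) (g 0)).
  pose (c := exp (- eps * s)).
  assert (Hc : 0 < c) by apply exp_pos.
  (* Chosen so that [c * t = M * B + c] exceeds [M * B]. *)
  pose (t := M * B / c + 1).
  assert (Ht : 0 < t).
  { assert (0 <= M * B / c); [|unfold t; lra]. unfold Rdiv. repeat apply Rmult_le_pos; try lra.
    apply Rlt_le, Rinv_0_lt_compat; auto. }
  assert (G : geodesic d (closed_itv 0 t) g).
  { apply geodesic_sub with half_line; auto; unfold half_line; lra. }
  pose proof (GH_geodesic_length (Rlt_le _ _ Ht) G) as H1.
  assert (M * D (g 0) (g t) <= M * B) by (apply Rmult_le_compat_l; [lra|auto]).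
  assert (c * t <= RInt (fun u => rho (g u)) 0 t).
  { replace (c * t) with (RInt (fun _ => c) 0 t).
    2:{ rewrite RInt_const. unfold scal; simpl; unfold mult; simpl. ring. }
    apply RInt_le; [lra|apply ex_RInt_const|apply (ex_RInt_geodesic Hrho); auto; lra|].
    intros u Hu. unfold c, rho, rho_eps. apply exp_le. specialize (Hdec u ltac:(lra)).
    assert (eps * b (g u) <= eps * s) by (apply Rmult_le_compat_l; lra). lra. }
  assert (c * t = M * B + c) by (unfold t; field; lra). lra.
Qed.

End Deformation.

(** * The uniformization theorem *)

Lemma busemann_along_ray (T : Type) (d : T -> T -> R) g t : is_metric d ->
  geodesic_ray d g -> 0 <= t -> busemann d g (g t) <= - t.
Proof.
  intros Hd Hg Ht. apply le_epsilon. intros e He.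
  destruct (busemann_limit Hd (g t) Hg He) as [N HN].
  pose proof (Rmax_l N t). pose proof (Rmax_r N t).
  specialize (HN (Rmax N t) ltac:(lra)).
  rewrite (proj2 Hg), (Rabs_right (Rmax N t - t)) in HN by (unfold half_line; lra).
  apply Rabs_def2 in HN. lra.
Qed.

Lemma metric_space_is_metric (X : Metric_Space) : is_metric (dist X).
Proof.
  split; [apply dist_pos|]. split; [apply dist_sym|]. split; [apply dist_refl|].
  apply dist_tri.
Qed.

Theorem theorem1p4 :
  forall (delta K eps M : R),
    0 <= delta -> 0 <= K -> 0 < eps -> 1 <= M ->
  exists A : R, 1 <= A /\
  forall (X : Metric_Space) (b : Base X -> R) (w : basepoint (Base X)),
    metric_complete (dist X) ->
    geodesic_space (dist X) ->
    delta_hyperbolic (dist X) delta ->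
    has_basepoint (dist X) b w ->
    roughly_starlike (dist X) K w ->
    GH_density (dist X) M (rho_eps eps b) ->
    (forall (I : R -> Prop) (g : R -> Base X),
       geodesic (dist X) I g -> uniform_curve (d_eps (dist X) eps b) A I g) /\
    uniform_space (d_eps (dist X) eps b) A /\
    (metric_bounded (d_eps (dist X) eps b) <-> in_D (dist X) b).
Proof.
  intros delta K eps M Hdelta HK Heps HM.
  pose (C := 2 * delta + 3).
  (* The first summand serves condition (i) and the second condition (ii); the sum dominates
     both. *)
  pose (A := M + M * exp (eps * (C + 1)) / eps).
  assert (HA : 0 < M * exp (eps * (C + 1)) / eps).
  { apply Rdiv_lt_0_compat; auto. apply Rmult_lt_0_compat; [lra|apply exp_pos]. }
  exists A. split; [unfold A; lra|]. intros X b w Hcomp Hgeo Hhyp Hb Hstar HGH.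
  pose proof (metric_space_is_metric X) as Hd.
  pose proof (basepoint_lipschitz Hd Hb) as Hlip.
  assert (HC : forall I g, geodesic (dist X) I g -> uniform_curve (d_eps (dist X) eps b) A I g).
  { intros I g Hg. destruct (proj1 Hg) as [[t1 I1] _].
    apply geodesic_uniform_curve with (M := M) (t1 := t1) (C := C); auto; try (unfold A; lra).
    intros t It. exact (basepoint_growth Hd Hb Hgeo Hhyp Hg It). }
  split; [exact HC|]. split; [split; [|split]|split].
  - now apply d_eps_metric with (M := M).
  - destruct w as [z|om].
    + destruct Hb as [s Hs]. destruct Hstar as [Hray _].
      destruct (Hray z) as [g [Hg [Hg0 _]]].
      (* On a ray from [z] one has [b (g u) = u + s], whence the slack 0. *)
      apply ray_not_complete with (M := M) (g := g) (C := 0); auto.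
      intros u Hu. rewrite !Hs, <- Hg0, (metric_refl Hd).
      rewrite (proj2 Hg), Rabs_right by (unfold half_line; lra). lra.
    + destruct Hstar as [Hline _]. pose proof Hb as [g0 _].
      destruct (Hline (g0 0)) as [g [Hg _]].
      assert (I0 : whole_line 0) by exact I.
      assert (Hitv : is_interval half_line).
      { split; [exists 0|]; unfold half_line; intros; lra. }
      (* The alternative at time 0 selects a half of the line along which [b] grows; the left half
         becomes a ray by reversing time. *)
      destruct (basepoint_growth Hd Hb Hgeo Hhyp Hg I0) as [H|H].
      * apply ray_not_complete with (M := M) (g := g) (C := C); auto.
        -- split; auto. intros s t _ _. now apply Hg.
        -- intros u Hu. specialize (H u I Hu). unfold C. lra.
      * apply ray_not_complete with (M := M) (g := fun t => g (- t)) (C := C); auto.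
        -- split; auto. intros s t _ _. rewrite (proj2 Hg) by exact I.
           replace (- s - - t) with (- (s - t)) by ring. apply Rabs_Ropp.
        -- intros u Hu. specialize (H (- u) I ltac:(lra)). rewrite Ropp_0. unfold C. lra.
  - intros x y. destruct (Hgeo x y) as [g [p [q [Hg Hj]]]]. exists g, p, q. auto.
  (* With a basepoint at infinity, [b] is at most [s - t] at time [t] of its defining ray, which
     contradicts boundedness. *)
  - intros Hbd. destruct w as [z|om]; [now exists z|]. exfalso.
    destruct Hb as [g [s [Hg [Hs _]]]]. revert Hbd.
    apply d_eps_unbounded with (M := M) (g := g) (s := s); auto.
    intros t Ht. rewrite Hs. pose proof (busemann_along_ray Hd Hg Ht). lra.
  - intros [z [s Hs]]. now apply d_eps_bounded with (M := M) (z := z) (s := s).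
Qed.
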